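(* Let $1\ll n_1\ll n_2$ and let $G=G(n_1,n_2,p)$ with $p=\frac{d}{\sqrt{n_1n_2}}$ for a constant $d>1$. Then whp $$g(G)=(1+o(1))\,\mu\!\left(d^2\right)\frac{d^2n_1}{2},$$ where for $c>1$, $$\mu(c)=\frac{1}{2}-\frac{1}{c}+\frac{1}{c^2}\sum_{k=1}^\infty\left(c e^{-c}\right)^k \frac{k^{k-2}}{k!}.$$
   Context: $G(n_1,n_2,p)$ denotes the binomial random bipartite graph: a random subgraph of $K_{n_1,n_2}$ (partition classes of sizes $n_1,n_2$) in which each edge is included independently with probability $p$. $g(G)$ is the genus of $G$. The notation $f\ll g$ means $f/g\to0$; $1\ll n_1$ means $n_1\to\infty$; ''whp'' means with probability tending to $1$ as $n_1\to\infty$. *)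

(* Defs.v *)
From HB Require Import structures.
From mathcomp Require Import all_boot all_order all_algebra all_fingroup.
From mathcomp Require Import all_classical all_reals all_analysis.
Set Implicit Arguments. Unset Strict Implicit. Unset Printing Implicit Defensive.
Import Order.TTheory GRing.Theory Num.Theory.

Section Genus.
Variables (V : finType) (adj : rel V).

Definition darts : {set V * V} := [set x | adj x.1 x.2].

Definition swapd (x : V * V) : V * V := (x.2, x.1).
Lemma swapdK : involutive swapd. Proof. by case. Qed.
Definition swap_perm : {perm (V * V)} := perm (inv_inj swapdK).

Definition rotation_system (sigma : {perm (V * V)}) : Prop :=
  [/\ forall x, x \notin darts -> sigma x = x,
      forall u v, adj u v -> (sigma (u, v)).1 = u /\ adj u (sigma (u, v)).2
    & forall u v w, adj u v -> adj u w -> (u, w) \in porbit sigma (u, v)].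

(* face permutation: (u,v) |-> sigma (v,u)   (mathcomp: (s * t) x = t (s x)) *)
Definition face_perm (sigma : {perm (V * V)}) : {perm (V * V)} :=
  swap_perm * sigma.

Definition isolated_vertices : {set V} := [set v | [forall w, ~~ adj v w]].

(* number of faces of the embedding given by sigma; every isolated vertex is
   a component embedded in its own sphere, contributing one face *)
Definition num_faces (sigma : {perm (V * V)}) : nat :=
  #|[set O in porbits (face_perm sigma) | O \subset darts]|
  + #|isolated_vertices|.

Definition num_components : nat := #|[set x | roots adj x]|.

(* Euler's formula summed over components:
   sum_i (2 - 2 g_i) = |V| - |E| + F, with 2|E| = #darts *)
Definition rs_genus (sigma : {perm (V * V)}) (g : nat) : Prop :=
  2 * (2 * g + #|V| + num_faces sigma) = 4 * num_components + #|darts|.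

Definition is_genus (g : nat) : Prop :=
  (exists2 sigma, rotation_system sigma & rs_genus sigma g) /\
  (forall sigma h, rotation_system sigma -> rs_genus sigma h -> (g <= h)%N).
End Genus.

Definition bip_adj (n1 n2 : nat) (S : {set 'I_n1 * 'I_n2})
  : rel ('I_n1 + 'I_n2)%type :=
  fun x y => match x, y with
             | inl i, inr j => (i, j) \in S
             | inr j, inl i => (i, j) \in S
             | _, _ => false
             end.

Local Open Scope ring_scope.

Definition prob_bip {R : realType} (n1 n2 : nat) (p : R)
  (P : {set 'I_n1 * 'I_n2} -> Prop) : R :=
  \sum_(S : {set 'I_n1 * 'I_n2} | `[< P S >])
     p ^+ #|S| * (1 - p) ^+ (n1 * n2 - #|S|).

Definition mu {R : realType} (c : R) : R :=
  2^-1 - c^-1 + c^-2 *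
    limn (fun N => \sum_(1 <= k < N)
            (c * expR (- c)) ^+ k * (k%:R ^+ (k - 2)%N / (k`!)%:R)).
Arguments prob_bip {R} n1 n2 p P.

(* Main.v *)
(* Write c = d^2. Right vertices of degree 0 or 1
   do not affect the genus and those of degree at least 3 are negligible, so G behaves like the graph H
   on the left vertices whose edges are the c n_1 / 2 right vertices of degree 2, that is, like
   G(n_1, c/n_1).
   By Euler's formula 2 g = ex(G) + q - F, where ex(G) = |E| - |V| + q, q is the number of components and
   F the maximal number of faces.
   Every component has a face, so 2 g <= ex(G). A face that traverses all its edges in both directions
   is an entire component; any other face meets a right vertex of degree at least 3, or is long, or lies
   on a bounded set of vertices with at least as many edges as vertices, and there are o(n_1) of these.
   Hence 2 g = ex(G) - o(n_1).
   The excess concentrates by the Efron-Stein inequality. Its mean is computed by counting the tree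
   components of H of each size k: Cayley's formula, in the weighted form where a forest counts with its
   number of rootings, gives the limit of their expected number divided by n_1. *)
Require Import Defs.
From HB Require Import structures.
From mathcomp Require Import all_classical all_reals all_analysis.
From mathcomp Require Import all_boot all_order all_algebra all_fingroup.
From mathcomp Require Import zify ring lra.
Set Implicit Arguments. Unset Strict Implicit. Unset Printing Implicit Defensive.
Import Order.TTheory GRing.Theory Num.Theory.
Import numFieldNormedType.Exports.

(** * Components by union-find *)

(** The theorem claims a relative error, so [mu (d ^+ 2)] must be shown positive. No functional
    equation of the tree function is used: the critical graph, d = 1, obeys the same limit laws, and
    there two counting facts (tree components cover at most n1 vertices, and the excess is
    nonnegative) control the tree series at c = 1; the mean value theorem then carries positivity to
    c > 1. The sample space is a product over right vertices, whose neighbourhoods are independent.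
    Emptying one neighbourhood changes the excess by less than its size, so the variance is O(n1)
    although there are far more than n1 coordinates. Cardinal inequalities stay in nat by
    multiplying with the cutoff [L] or [K] instead of dividing by it. *)

Section UnionFind.
Variable T : finType.
Implicit Types (l : seq (T * T)) (x y z : T).

(* [uf l x] is a representative of the component of [x] in the graph with edge list [l]. *)
Fixpoint uf l : T -> T :=
  if l is e :: l' then
    fun z => if uf l' z == uf l' e.1 then uf l' e.2 else uf l' z
  else id.

Definition ncl l := #|uf l @: [set: T]|.

Lemma uf_cons_mono e l a b : uf l a = uf l b -> uf (e :: l) a = uf (e :: l) b.
Proof. by move=> /= ->. Qed.

Lemma uf_edge e l : e \in l -> uf l e.1 = uf l e.2.
Proof.
elim: l => //= f l IH; rewrite inE => /predU1P[->|/IH ->//].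
by rewrite eqxx; case: eqP.
Qed.

(** A map constant along the edges factors through [uf l]. Later proofs take [g] to be membership in
    a set, or a class recorded only on a set and [None] elsewhere. *)
Lemma uf_univ (U : eqType) (g : T -> U) l :
  (forall e, e \in l -> g e.1 = g e.2) ->
  forall a b, uf l a = uf l b -> g a = g b.
Proof.
elim: l => [_ a b /= -> //|e l IH H a b /=].
have {}IH := IH (fun f fl => H f (mem_behead (s := e :: l) fl)).
have He := H e (mem_head _ _).
case: eqP => [/IH ae|ne]; case: eqP => [/IH be|ne'].
- by rewrite ae be.
- by move/IH; rewrite ae He => ->.
- by move/IH => ->; rewrite be He.
- exact: IH.
Qed.

Lemma uf_sub l l' : (forall e, e \in l -> uf l' e.1 = uf l' e.2) ->
  forall a b, uf l a = uf l b -> uf l' a = uf l' b.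
Proof. exact: uf_univ. Qed.

Lemma uf_subset l l' : {subset l <= l'} ->
  forall a b, uf l a = uf l b -> uf l' a = uf l' b.
Proof. by move=> s; apply: uf_sub => e /s; exact: uf_edge. Qed.

(** On [A] the map [g] factors through [f]. This compares numbers of classes without explicit
    bijections. *)
Lemma card_imset_kernel (U V W : finType) (f : U -> V) (g : U -> W) (A : {set U}) :
  {in A &, forall a b, f a = f b -> g a = g b} -> #|g @: A| <= #|f @: A|.
Proof.
move=> fg; case: (set_0Vmem A) => [->|[a0 a0A]]; first by rewrite !imset0 !cards0.
pose h v := g (odflt a0 [pick a in A | f a == v]).
rewrite (_ : g @: A = h @: (f @: A)) ?leq_imset_card //.
rewrite -imset_comp; apply: eq_in_imset => a aA /=; rewrite /h.
case: pickP => [b /andP[bA /eqP fb]|/(_ a)] /=; last by rewrite aA eqxx.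
by apply: fg.
Qed.

Lemma ncl_le l l' : (forall e, e \in l' -> uf l e.1 = uf l e.2) -> ncl l <= ncl l'.
Proof. by move=> H; apply: card_imset_kernel => a b _ _; apply: uf_sub. Qed.

Lemma ncl_eq l l' : (forall e, e \in l -> uf l' e.1 = uf l' e.2) ->
  (forall e, e \in l' -> uf l e.1 = uf l e.2) -> ncl l = ncl l'.
Proof. by move=> H1 H2; apply/eqP; rewrite eqn_leq !ncl_le. Qed.

Lemma ncl_subset l l' : {subset l <= l'} -> ncl l' <= ncl l.
Proof. by move=> s; apply: ncl_le => e /s; exact: uf_edge. Qed.

Lemma ncl_eq_mem l l' : l =i l' -> ncl l = ncl l'.
Proof.
by move=> s; apply/eqP; rewrite eqn_leq !ncl_subset // => x; rewrite s.
Qed.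

Lemma ncl_nil : ncl [::] = #|T|.
Proof. by rewrite /ncl imset_id cardsT. Qed.

(** When the edge joins two classes, exactly the representative [uf l e.1] disappears, redirected to
    [uf l e.2]. *)
Lemma ncl_cons e l : ncl (e :: l) + (uf l e.1 != uf l e.2) = ncl l.
Proof.
rewrite /ncl; case: eqP => [E|/eqP ne] /=.
  rewrite addn0; congr #|pred_of_set _|; apply: eq_imset => z /=.
  by rewrite -E; case: eqP.
rewrite (cardsD1 (uf l e.1) (uf l @: [set: T])) imset_f // addnC; congr (_ + #|pred_of_set _|).
apply/setP=> t; apply/imsetP/setD1P => [[z _ ->]|[nt /imsetP[z _ Ez]]].
  case: (boolP (uf l z == uf l e.1)) => [_|nz]; first by rewrite eq_sym imset_f.
  by rewrite imset_f.
by exists z => //; rewrite -Ez (negPf nt).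
Qed.

Lemma ncl_cat_size l1 l2 : ncl l2 <= ncl (l1 ++ l2) + size l1.
Proof.
elim: l1 => [|e l1 IH] /=; first by rewrite addn0.
have := ncl_cons e (l1 ++ l2); lia.
Qed.

Lemma ncl_size l : #|T| <= ncl l + size l.
Proof. by have := ncl_cat_size l [::]; rewrite cats0 ncl_nil. Qed.

Lemma ncl_connected l (A : {set T}) x : (forall y, y \in A -> uf l y = uf l x) ->
  ncl l + #|A| <= #|T| + 1.
Proof.
move=> H; have sub : uf l @: [set: T] \subset uf l x |: (uf l @: ~: A).
  apply/subsetP=> _ /imsetP[z _ ->]; case: (boolP (z \in A)) => [/H->|zA].
    by rewrite setU11.
  by rewrite inE imset_f ?orbT // inE.
have := subset_leq_card sub; rewrite cardsU1.
have := leq_imset_card (uf l) (~: A); have := cardsC A.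
rewrite /ncl; case: (_ \in _) => /=; lia.
Qed.

Definition erel l : rel T := [rel a b | ((a, b) \in l) || ((b, a) \in l)].

Lemma uf_connect l a b : (uf l a == uf l b) = connect (erel l) a b.
Proof.
apply/eqP/idP => [|/connectP[p]]; last first.
  elim: p a => [a _ -> //|c p IH a /= /andP[ac pc] E].
  rewrite -(IH c pc E); case/orP: ac => /uf_edge /= -> //.
have sy : connect_sym (erel l).
  by apply: sym_connect_sym => u v; apply: orbC.
move=> /(uf_univ (g := fingraph.root (erel l))) H; apply/(fingraph.rootP sy)/H.
by case=> u v e; apply/(fingraph.rootP sy)/connect1; apply/orP; left.
Qed.

Lemma ncl_roots l (e : rel T) : e =2 erel l -> #|[set x | roots e x]| = ncl l.
Proof.
move=> ee.
have ce : connect e =2 connect (erel l) by apply: eq_connect.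
have sy : connect_sym e.
  by move=> u v; rewrite !ce -!uf_connect eq_sym.
rewrite /ncl -(@card_in_imset _ _ (uf l)) => [|x y]; last first.
  rewrite !inE => /eqP rx /eqP ry /eqP; rewrite uf_connect -ce => /(fingraph.rootP sy).
  by rewrite rx ry.
congr #|pred_of_set _|; apply/setP=> t; apply/imsetP/imsetP => -[z _ ->]; first by exists z.
exists (fingraph.root e z); first by rewrite inE roots_root.
by apply/eqP; rewrite uf_connect -ce connect_root.
Qed.

End UnionFind.

(** * Rotation systems and Euler's formula *)

Ltac card_lia :=
  repeat match goal with
  | |- context [#|?A|] => let n := fresh "n" in set n := #|A|; clearbody n
  | |- context [ncl ?l] => let n := fresh "n" in set n := ncl l; clearbody n
  | |- context [size ?l] => let n := fresh "n" in set n := size l; clearbody n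
  end; lia.

Lemma card_porbits_fix (T : finType) (s : {perm T}) (A : {set T}) :
  (forall x, x \notin A -> s x = x) ->
  #|porbits s| = #|[set O in porbits s | O \subset A]| + #|~: A|.
Proof.
move=> fixA.
have porb1 x : x \notin A -> porbit s x = [set x].
  move=> xA; apply/setP=> y; rewrite inE; apply/idP/eqP => [|->]; last exact: porbit_id.
  case/porbitP => i ->; elim: i => [|i IH]; first by rewrite expg0 perm1.
  by rewrite expgSr permM IH fixA.
rewrite -(cardsID [set O : {set T} | O \subset A] (porbits s)); congr (_ + _).
  by congr #|pred_of_set _|; apply/setP=> O; rewrite !inE.
rewrite -(card_in_imset (f := porbit s) (D := ~: A)); last first.
  by move=> x y; rewrite !inE => xA yA; rewrite !porb1 // => /set1_inj.
congr #|pred_of_set _|; apply/setP=> O; rewrite !inE.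
apply/andP/imsetP => [[nO /imsetP[x _ EO]]|[x]]; last first.
  rewrite inE => xA ->; rewrite imset_f // porb1 // sub1set; split => //.
have: exists2 y, y \in O & y \notin A by apply/subsetPn.
case=> y yO yA; exists y; rewrite ?inE //.
by rewrite EO; apply/eqP; rewrite eq_porbit_mem porbit_sym -EO.
Qed.

Lemma porbit_ind (T : finType) (s : {perm T}) (P : T -> Prop) x :
  P x -> (forall y, y \in porbit s x -> P y -> P (s y)) ->
  forall y, y \in porbit s x -> P y.
Proof.
move=> Px PS y /porbitP[i ->]; elim: i => [|i IH]; first by rewrite expg0 perm1.
by rewrite expgSr permM; apply: PS => //; apply: mem_porbit.
Qed.

Lemma mem_porbit_step (T : finType) (s : {perm T}) x y :
  (s y \in porbit s x) = (y \in porbit s x).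
Proof. by have := porbit_perm s 1 y; rewrite expg1 -!eq_porbit_mem => ->. Qed.

Section Euler.
Variables (V : finType) (adj : rel V).
Hypothesis adj_sym : symmetric adj.
Variable l : seq (V * V).
Hypothesis l_uniq : uniq l.
Hypothesis l_swap : forall x, x \in l -> swapd x \notin l.
Hypothesis l_adj : forall u v, adj u v = ((u, v) \in l) || ((v, u) \in l).
Variable sigma : {perm (V * V)}.
Hypothesis rsig : rotation_system adj sigma.

Let D := darts adj.
Let face := face_perm sigma.
Let iso := isolated_vertices adj.

Lemma dartsE x : (x \in D) = (x \in l) || (swapd x \in l).
Proof. by case: x => u v; rewrite inE /= l_adj. Qed.

Lemma darts_swapd x : (swapd x \in D) = (x \in D).
Proof. by case: x => u v; rewrite !inE /= adj_sym. Qed.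

Lemma faceE x : face x = sigma (swapd x).
Proof. by rewrite permM permE. Qed.

Lemma sigma1 x : (sigma x).1 = x.1.
Proof.
have [fixD si _] := rsig; case: (boolP (x \in D)) => [|/fixD-> //].
by case: x => u v; rewrite inE /= => /si[].
Qed.

Lemma sigma_darts x : (sigma x \in D) = (x \in D).
Proof.
have [fixD si _] := rsig; case: (boolP (x \in D)) => xD.
  case: x xD => u v; rewrite inE /= => /si[E1 E2].
  by case: (sigma _) E1 E2 => a b /= -> E; rewrite inE.
by rewrite fixD // (negPf xD).
Qed.

Lemma face1 x : (face x).1 = x.2.
Proof. by rewrite faceE sigma1; case: x. Qed.

Lemma face_darts x : (face x \in D) = (x \in D).
Proof. by rewrite faceE sigma_darts darts_swapd. Qed.

Lemma porbit_darts x : x \in D -> porbit face x \subset D.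
Proof.
move=> xD; apply/subsetP; apply: porbit_ind => // y _ yD.
by rewrite face_darts.
Qed.

Lemma sigma_porbit_darts x y : x \in D -> y \in D ->
  (porbit sigma x == porbit sigma y) = (x.1 == y.1).
Proof.
have [fixD si tr] := rsig; case: x => u v; case: y => u' v'; rewrite !inE /= => xD yD.
apply/idP/eqP => [|E]; last by subst u'; rewrite eq_porbit_mem; apply: tr.
rewrite eq_porbit_mem => H.
by apply: (porbit_ind (P := fun z => z.1 = u') _ _ H) => //= y _ Py; rewrite sigma1.
Qed.

Lemma card_iso_dart : #|iso| + #|[set x.1 | x in D]| = #|V|.
Proof.
rewrite -(cardsC iso); congr (_ + #|pred_of_set _|); apply/setP=> u.
rewrite !inE negb_forall; apply/imsetP/existsP => [[[a b]]|[w]].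
  by rewrite inE /= => ab ->; exists b; rewrite ab.
by rewrite negbK => uw; exists (u, w); rewrite ?inE.
Qed.

(** The cycles of [sigma] on darts are the rotations at the non-isolated vertices; off the darts it
    is the identity. This is Euler's formula before any edge is inserted. *)
Lemma card_porbits_sigma : #|porbits sigma| + #|iso| = #|V| + #|~: D|.
Proof.
have [fixD si tr] := rsig.
rewrite (card_porbits_fix fixD) -card_iso_dart.
suff E : #|[set O in porbits sigma | O \subset D]| = #|[set x.1 | x in D]|.
  by rewrite E addnAC [#|iso| + _]addnC.
have -> : [set O in porbits sigma | O \subset D] = porbit sigma @: D.
  apply/setP=> O; rewrite !inE; apply/andP/imsetP => [[/imsetP[x _ ->] s]|[x xD ->]].
    by exists x => //; apply: (subsetP s); apply: porbit_id.
  rewrite imset_f //; split=> //; apply/subsetP; apply: porbit_ind => // y _.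
  by rewrite sigma_darts.
apply/eqP; rewrite eqn_leq; apply/andP; split; apply: card_imset_kernel => x y xD yD /eqP.
  by rewrite -sigma_porbit_darts // => /eqP.
by rewrite sigma_porbit_darts // => /eqP.
Qed.

(** Face tracing built edge by edge: each inserted edge exchanges its two darts. For the full list
    this agrees with [face] on darts, but it fixes all other pairs, which [face] reverses. *)
Definition inserted_perm (k : seq (V * V)) : {perm (V * V)} :=
  foldr (fun x s => tperm x (swapd x) * s)%g sigma k.

Lemma inserted_perm_uf k x : uf k (inserted_perm k x).1 = uf k x.1.
Proof.
elim: k x => [|e k IH] x; first by rewrite /= sigma1.
rewrite /= permM; have {}IH := uf_cons_mono e (IH (tperm e (swapd e) x)).
move: IH => /= ->.
have := uf_edge (mem_head e k) => /= E.
case: tpermP => [->|->|//] /=; last exact: E.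
by rewrite -E.
Qed.

Lemma inserted_perm_porbit_uf k x y : y \in porbit (inserted_perm k) x -> uf k y.1 = uf k x.1.
Proof. by move: y; apply: porbit_ind => // y _ <-; rewrite inserted_perm_uf. Qed.

(* Inserting the edges one at a time, each step multiplies the permutation by a transposition: it
   joins two cycles if the edge joins two classes, and otherwise changes the number of cycles by one;
   [g] counts the steps of the latter kind that join two cycles. *)
Lemma inserted_perm_euler k : (forall x, x \in k -> x \in D) ->
  exists g, #|porbits (inserted_perm k)| + #|iso| + 2 * g + #|V| = size k + 2 * ncl k + #|~: D|.
Proof.
elim: k => [_|e k IH kD].
  exists 0; rewrite /= ncl_nil; have := card_porbits_sigma; card_lia.
case: IH => [x xk|g IH]; first by apply: kD; rewrite inE xk orbT.
have ne : e != swapd e.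
  apply/eqP=> E; have : e \in D by apply: kD; rewrite mem_head.
  rewrite dartsE -E orbb => el.
  by move: (l_swap el); rewrite -E el.
have := porbits_mul_tperm (inserted_perm k) e (swapd e); have := ncl_cons e k.
rewrite ne /=; case: (boolP (uf k e.1 != uf k e.2)) => ufe /=.
  (* Cycles stay inside classes, so the two darts of an edge joining two classes lie on distinct
     cycles. *)
  have -> : e \notin porbit (inserted_perm k) (swapd e).
    by apply: contra ufe => /inserted_perm_porbit_uf /= ->.
  move=> H1 H2; exists g; move: H1 H2 IH; rewrite -?muln2 ?mul1n; card_lia.
case: (e \notin porbit _ _) => /= H1 H2; [exists g.+1|exists g]; move: H1 H2 IH; rewrite -?muln2 ?mul1n; card_lia.
Qed.
Lemma inserted_perm_out k x : x \notin k -> swapd x \notin k -> inserted_perm k x = sigma x.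
Proof.
elim: k => //= e k IH; rewrite !inE !negb_or => /andP[xe xk] /andP[sxe sxk].
rewrite permM tpermD ?IH // eq_sym //.
by apply: contraNneq sxe => ->; rewrite swapdK.
Qed.

(** As [k] holds one dart of each of its edges, exactly one transposition moves [x]. *)
Lemma inserted_perm_in k x : uniq k -> (forall x, x \in k -> swapd x \notin k) ->
  (x \in k) || (swapd x \in k) -> inserted_perm k x = sigma (swapd x).
Proof.
elim: k => //= e k IH /andP[ek uk] sk xk.
have sek : swapd e \notin k.
  by have := sk e (mem_head _ _); rewrite inE negb_or => /andP[].
rewrite permM; case: (altP (x =P e)) => [->|xe].
  by rewrite tpermL inserted_perm_out // swapdK.
case: (altP (x =P swapd e)) => [->|xse]; first by rewrite tpermR swapdK inserted_perm_out.
rewrite tpermD 1?eq_sym //; apply: IH => // [y yk|].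
  by have := sk y; rewrite !inE yk orbT negb_or => /(_ isT) /andP[].
move: xk; rewrite !inE (negPf xe) /=; case/orP => [->//|/predU1P[E|->]].
  by rewrite -E swapdK eqxx in xse.
by rewrite orbT.
Qed.

Lemma inserted_perm_face x : x \in D -> inserted_perm l x = face x.
Proof. by rewrite dartsE faceE => xD; apply: inserted_perm_in. Qed.

Lemma inserted_perm_fix x : x \notin D -> inserted_perm l x = x.
Proof.
have [fixD _ _] := rsig.
by move=> xD; have := xD; rewrite dartsE negb_or => /andP[*]; rewrite inserted_perm_out // fixD.
Qed.

Definition faces := [set O in porbits face | O \subset D].

Lemma facesE : faces = [set porbit face x | x in D].
Proof.
apply/setP=> O; rewrite inE; apply/andP/imsetP => [[/imsetP[x _ ->] s]|[x xD ->]].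
  by exists x => //; apply: (subsetP s); apply: porbit_id.
by rewrite imset_f // porbit_darts.
Qed.

Lemma inserted_perm_porbit x : x \in D -> porbit (inserted_perm l) x = porbit face x.
Proof.
move=> xD; apply/setP=> y; apply/idP/idP; move: y; apply: porbit_ind; rewrite ?porbit_id //.
  move=> y _ yO; have yD := subsetP (porbit_darts xD) _ yO.
  by rewrite inserted_perm_face // mem_porbit_step.
move=> y yO yP; have yD := subsetP (porbit_darts xD) _ yO.
by rewrite -inserted_perm_face // mem_porbit_step.
Qed.

Lemma card_porbits_inserted_perm : #|porbits (inserted_perm l)| = #|faces| + #|~: D|.
Proof.
rewrite (card_porbits_fix inserted_perm_fix); congr (#|pred_of_set _| + _).
rewrite facesE; apply/setP=> O; rewrite inE.
apply/andP/imsetP => [[/imsetP[x _ ->] s]|[x xD ->]].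
  have xD : x \in D by apply: (subsetP s); apply: porbit_id.
  by exists x => //; rewrite inserted_perm_porbit.
by rewrite -inserted_perm_porbit // imset_f // inserted_perm_porbit // porbit_darts.
Qed.

(** The witness is the genus. That it is a natural number, rather than a possibly negative or
    half-integral defect, is what makes the minimum in [is_genus] meaningful. *)
Lemma euler_formula :
  exists g, num_faces adj sigma + 2 * g + #|V| = size l + 2 * ncl l.
Proof.
have [x xl|g] := @inserted_perm_euler l; first by rewrite dartsE xl.
rewrite card_porbits_inserted_perm => H; exists g; rewrite /num_faces -/D -/face -/iso -/faces.
by move: H; card_lia.
Qed.

Lemma card_darts : #|D| = 2 * size l.
Proof.
have u : uniq (l ++ map (@swapd V) l).
  rewrite cat_uniq l_uniq map_inj_uniq ?l_uniq ?andbT /=; last exact: (inv_inj (@swapdK V)).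
  by apply/hasPn=> _ /mapP[x xl ->]; apply: l_swap.
rewrite mul2n -addnn -[X in _ + X](size_map (@swapd V)) -size_cat -(card_uniqP u).
apply: eq_card => x; rewrite dartsE mem_cat; congr (_ || _).
by rewrite -[in RHS](swapdK x) mem_map //; apply: (inv_inj (@swapdK V)).
Qed.

Lemma erelE u v : erel l u v = adj u v.
Proof. by rewrite l_adj. Qed.

Lemma num_componentsE : num_components adj = ncl l.
Proof. by apply: ncl_roots => u v; rewrite l_adj. Qed.

Lemma rs_genusE g : rs_genus adj sigma g <->
  num_faces adj sigma + 2 * g + #|V| = size l + 2 * ncl l.
Proof.
rewrite /rs_genus -/D card_darts num_componentsE.
by split; move: (num_faces _ _); card_lia.
Qed.

Lemma face_uf x y : x \in D -> y \in porbit face x -> uf l y.1 = uf l x.1.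
Proof.
move=> xD; move: y; apply: porbit_ind => // y yO <-.
have := subsetP (porbit_darts xD) _ yO; rewrite face1 dartsE.
by case/orP => /uf_edge.
Qed.

Lemma ncl_le_num_faces : ncl l <= num_faces adj sigma.
Proof.
rewrite /num_faces -/D -/face -/iso -/faces /ncl.
have -> : [set: V] = [set x.1 | x in D] :|: iso.
  apply/setP=> u; rewrite !inE; case: (boolP [forall _, _]); rewrite ?orbT ?orbF // => /forallPn[w].
  by rewrite negbK => uw; apply/esym/imsetP; exists (u, w); rewrite ?inE.
rewrite imsetU; apply: leq_trans (leq_card_setU _ _) _.
apply: leq_add (leq_imset_card _ _).
rewrite facesE -imset_comp; apply: card_imset_kernel => x y xD yD /= E.
by apply: face_uf => //; rewrite -eq_porbit_mem E.
Qed.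

Definition closed_face (O : {set V * V}) := [forall x in O, swapd x \in O].

(** A closed face is stable under [face] and reversal, hence under [sigma]. Transitivity of the
    rotations then gives all darts at its vertices, and walking along edges gives the whole
    component. *)
Lemma closed_face_all O x y : O \in faces -> closed_face O -> x \in O -> y \in D ->
  uf l x.1 = uf l y.1 -> y \in O.
Proof.
rewrite facesE => /imsetP[z zD EO] /forall_inP cl xO yD /eqP.
have fO a : (face a \in O) = (a \in O) by rewrite EO mem_porbit_step.
have sO a : a \in O -> sigma a \in O.
  by move=> /cl sa; have := fO (swapd a); rewrite faceE swapdK sa.
have tO a b : a \in O -> b \in D -> a.1 = b.1 -> b \in O.
  move=> aO bD ab; have aD : a \in D by apply: (subsetP (porbit_darts zD)); rewrite -EO.
  have: b \in porbit sigma a by rewrite porbit_sym -eq_porbit_mem sigma_porbit_darts ?ab.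
  by move: b {bD ab}; apply: porbit_ind => // b _; apply: sO.
rewrite uf_connect => /connectP[p].
elim: p x xO => [|w p IH] x xO /=; first by move=> _ E; apply: tO xO yD _.
case/andP => xw; apply: (IH (w, x.1)).
rewrite -[(w, x.1)]/(swapd (x.1, w)); apply/cl/(tO _ _ xO) => //.
by rewrite inE /= l_adj.
Qed.

(** A closed face is determined by its component, and an isolated vertex is a component of its own;
    hence closed faces and isolated vertices together number at most [ncl l]. *)
Lemma num_faces_le : num_faces adj sigma <=
  ncl l + #|[set O in faces | ~~ closed_face O]|.
Proof.
rewrite /num_faces -/D -/face -/iso -/faces.
rewrite -(cardsID [set O | closed_face O] faces) addnAC leq_add //; last first.
  by apply: subset_leq_card; apply/subsetP=> O; rewrite !inE andbC.
have -> : #|iso| = #|uf l @: iso|.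
  rewrite card_in_imset // => u v; rewrite !inE => iu iv E.
  apply/eqP; move/eqP: E; rewrite uf_connect => /connectP[[|w p] /=]; first by move=> _ ->.
  by rewrite erelE (negPf (forallP iu w)).
set C := _ :&: _.
set X := [set x in D | closed_face (porbit face x)].
have -> : C = porbit face @: X.
  apply/setP=> O; rewrite inE facesE inE; apply/andP/imsetP => [[/imsetP[x xD ->] c]|[x]].
    by exists x => //; rewrite inE xD.
  by rewrite inE => /andP[xD c ->]; rewrite imset_f.
have le : #|porbit face @: X| <= #|[set uf l x.1 | x in X]|.
  apply: card_imset_kernel => x y /setIdP[xD xc] /setIdP[yD yc] E.
  apply/eqP; rewrite eq_sym eq_porbit_mem.
  have xf : porbit face x \in faces by rewrite facesE imset_f.
  exact: (closed_face_all xf xc (porbit_id _ _) yD E).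
apply: leq_trans (leq_add le (leqnn _)) _.
have dis : [disjoint [set uf l x.1 | x in X] & uf l @: iso].
  rewrite -setI_eq0; apply/eqP/setP=> t; rewrite !inE; apply/negP=> /andP[].
  case/imsetP=> x /setIdP[xD _] -> /imsetP[u iu /esym/eqP].
  rewrite uf_connect => /connectP[[|w p] /=].
    move=> _ E; move: iu xD; rewrite !inE -E => /forallP/(_ x.2).
    by case: x {E} => a b /= /negPf ->.
  by move: iu; rewrite inE => /forallP/(_ w); rewrite erelE => /negPf ->.
have /leqifP := leq_card_setU [set uf l x.1 | x in X] (uf l @: iso).
rewrite dis => /eqP <-; rewrite subset_leq_card //.
by apply/subsetP=> t; rewrite inE => /orP[] /imsetP[u _ ->]; rewrite imset_f ?inE.
Qed.
(* A face missing the reverse of its dart [x] stays connected without the edge of [x]. *)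
Lemma card_face_vertices O : O \in faces -> ~~ closed_face O ->
  #|[set y.1 | y in O]| <= count (fun e => (e \in O) || (swapd e \in O)) l.
Proof.
rewrite facesE => /imsetP[z zD EO] /forall_inPn[x xO sxO].
set l' := [seq e <- l | (e \in O) || (swapd e \in O)]; rewrite -size_filter -/l'.
set l1 := [seq e <- l' | (e != x) && (swapd e != x)].
have OD y : y \in O -> y \in D by rewrite EO; apply: (subsetP (porbit_darts zD)).
have EO' : O = porbit face (face x).
  by rewrite EO; apply/eqP; rewrite eq_porbit_mem porbit_sym mem_porbit_step -EO.
have con : forall y, y \in O -> uf l1 y.1 = uf l1 (face x).1.
  rewrite {1}EO'; apply: porbit_ind => // y; rewrite -EO' => yO IH.
  case: (altP (y =P x)) => [-> //|yx]; rewrite -IH face1.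
  have syx : swapd y != x by apply: contraNneq sxO => <-; rewrite swapdK.
  have := OD _ yO; rewrite dartsE => /orP[] yl.
    by apply/esym/uf_edge; rewrite !mem_filter yx syx yO yl.
  by apply: (uf_edge (e := swapd y)); rewrite !mem_filter swapdK yx syx yO yl orbT.
have := @ncl_connected _ l1 [set y.1 | y in O] (face x).1.
have /[swap] /[apply] : forall v, v \in [set y.1 | y in O] -> uf l1 v = uf l1 (face x).1.
  by move=> _ /imsetP[y yO ->]; apply: con.
have := ncl_size l1.
have: size l1 < size l'.
  have := OD _ xO; rewrite dartsE => xl.
  pose e0 := if x \in l then x else swapd x.
  have : size (e0 :: l1) <= size l'.
    apply: uniq_leq_size => /=.
      rewrite !filter_uniq // andbT mem_filter /e0; case: ifP; rewrite ?eqxx //=.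
      by rewrite swapdK eqxx andbF.
    move=> e; rewrite inE => /predU1P[->|]; last by rewrite mem_filter => /andP[].
    move: xl; rewrite mem_filter /e0; case: ifP => [->|_ /= ->]; rewrite ?xO //.
    by rewrite swapdK xO orbT.
  by [].
card_lia.
Qed.
End Euler.

(** * Existence of a rotation system *)

Section Rotation.
Variables (V : finType) (adj : rel V).

Let nb u := enum (adj u).

Let rot_fun (x : V * V) := if adj x.1 x.2 then (x.1, next (nb x.1) x.2) else x.

Lemma rot_fun_inj : injective rot_fun.
Proof.
have mn u v : adj u v -> adj u (next (nb u) v).
  move=> uv; have: next (nb u) v \in nb u by rewrite mem_next mem_enum.
  by rewrite mem_enum.
move=> [u v] [u' v']; rewrite /rot_fun /=.
case: ifP => uv; case: ifP => uv' [] // E1 E2.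
- subst u'; congr (_, _).
  by rewrite -(prev_next (enum_uniq (adj u)) v) -/(nb u) E2 prev_next ?enum_uniq.
- by move: uv'; rewrite -E1 -E2 mn.
- by move: uv; rewrite E1 E2 mn.
- by rewrite E1 E2.
Qed.

(** Any cyclic order of the neighbours works; the one used is their enumeration order. *)
Lemma rotation_system_exists : exists sigma, rotation_system adj sigma.
Proof.
exists (perm rot_fun_inj); split => [x|u v uv|u v w uv uw].
- by rewrite inE permE /rot_fun => /negPf ->.
- rewrite permE /rot_fun /= uv; split=> //=.
  have: next (nb u) v \in nb u by rewrite mem_next mem_enum.
  by rewrite mem_enum.
have fc : fcycle (next (nb u)) (nb u) by apply: cycle_next; apply: enum_uniq.
have : fconnect (next (nb u)) v w.
  by rewrite (fconnect_cycle fc) mem_enum.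
move=> /iter_findex; set i := findex _ _ _ => Ei.
suff -> : (u, w) = ((perm rot_fun_inj) ^+ i)%g (u, v) by apply: mem_porbit.
rewrite -{}Ei permX.
suff H : adj u (iter i (next (nb u)) v) /\ (u, iter i (next (nb u)) v) = iter i (perm rot_fun_inj) (u, v) by case: H.
elim: i => [|i [IH1 IH2]] //=; rewrite -IH2 permE /rot_fun /= IH1; split=> //.
have: next (nb u) (iter i (next (nb u)) v) \in nb u by rewrite mem_next mem_enum.
by rewrite mem_enum.
Qed.
End Rotation.

(** * Faces of bipartite graphs *)

Section Bipartite.
Variables (n1 n2 : nat).
Local Notation I1 := 'I_n1.
Local Notation I2 := 'I_n2.
Implicit Types (S : {set I1 * I2}) (nu : I2 -> {set I1}).

Definition nbr S : I2 -> {set I1} := fun j => [set i | (i, j) \in S].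

Definition num_deg2 nu := #|[set j | #|nu j| == 2]|.
(** The number of edges at right vertices of degree at least 3, which bounds the number of faces
    through such vertices. *)
Definition deg3_mass nu := \sum_(j | 2 < #|nu j|) #|nu j|.

(* Balanced pairs of sets spanning a subgraph with at least as many edges as vertices. *)
Definition dense_pair nu (P : {set I1} * {set I2}) :=
  (#|P.1| == #|P.2|) && [forall j in P.2, 1 < #|nu j :&: P.1|].
(** A face is recovered from any one of its darts, so each pair is weighted by the number of
    possible darts between its sides. *)
Definition dense_mass L nu :=
  \sum_(P : {set I1} * {set I2} | (0 < #|P.1| <= L) && dense_pair nu P) #|P.1| * #|P.2|.

Definition edge_seq S : seq ((I1 + I2) * (I1 + I2)) :=
  [seq (inl x.1, inr x.2) | x <- enum S].

Lemma card_edges S (P : pred I2) :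
  #|[set x in S | P x.2]| = \sum_(j | P j) #|nbr S j|.
Proof.
rewrite -sum1_card (partition_big snd P) => [|x]; last by rewrite inE => /andP[].
apply: eq_bigr => j Pj; rewrite -sum1_card.
rewrite (reindex_onto (fun i => (i, j)) fst) => [|[i k]] /=; last by case/andP => _ /eqP ->.
by apply: eq_bigl => i; rewrite !inE /= Pj !eqxx !andbT.
Qed.

Lemma edge_seq_uniq S : uniq (edge_seq S).
Proof. by rewrite map_inj_uniq ?enum_uniq // => -[a b] [c d] [-> ->]. Qed.

Lemma mem_edge_seq S i j : ((inl i, inr j) \in edge_seq S) = ((i, j) \in S).
Proof.
apply/mapP/idP => [[[a b]]|ij]; first by rewrite mem_enum => H [-> ->].
by exists (i, j); rewrite ?mem_enum.
Qed.

Lemma edge_seqP S x : x \in edge_seq S -> exists2 e, e \in S & x = (inl e.1, inr e.2).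
Proof. by case/mapP=> e; rewrite mem_enum; exists e. Qed.

Lemma edge_seq_swap S x : x \in edge_seq S -> swapd x \notin edge_seq S.
Proof. by case/edge_seqP=> e _ ->; apply/negP=> /edge_seqP[f _]. Qed.

Lemma bip_adjE S u v :
  bip_adj S u v = ((u, v) \in edge_seq S) || ((v, u) \in edge_seq S).
Proof.
have n1' a b : (inl a, inl b) \in edge_seq S = false by apply/negP=> /edge_seqP[f _].
have n2' a b : (inr a, inr b) \in edge_seq S = false by apply/negP=> /edge_seqP[f _].
have n3' a b : (inr a, inl b) \in edge_seq S = false by apply/negP=> /edge_seqP[f _].
by case: u v => u [] v /=; rewrite ?n1' ?n2' ?n3' ?mem_edge_seq ?orbF.
Qed.

Lemma bip_adj_sym S : symmetric (bip_adj S).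
Proof. by move=> u v; rewrite !bip_adjE orbC. Qed.

Lemma size_edge_seq S : size (edge_seq S) = \sum_j #|nbr S j|.
Proof.
rewrite size_map -cardE -card_edges; apply: eq_card => x.
by rewrite inE andbT.
Qed.

(** * Faces that are not entire components *)

Section Faces.
Variables (S : {set I1 * I2}) (sigma : {perm ((I1 + I2) * (I1 + I2))}).
Hypothesis rsig : rotation_system (bip_adj S) sigma.
Let face := face_perm sigma.
Let nu := nbr S.
Let fcs := faces (bip_adj S) sigma.
Let dart (x : I1 * I2) : (I1 + I2) * (I1 + I2) := (inr x.2, inl x.1).
Let fcsE := facesE (@bip_adj_sym S) rsig.

Definition face_left (O : {set (I1 + I2) * (I1 + I2)}) : {set I1} :=
  [set i | inl i \in [set y.1 | y in O]].
Definition face_right (O : {set (I1 + I2) * (I1 + I2)}) : {set I2} :=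
  [set j | inr j \in [set y.1 | y in O]].

Let face_stepE O y : O \in fcs -> (face y \in O) = (y \in O).
Proof. by rewrite /fcs fcsE => /imsetP[z _ ->]; rewrite mem_porbit_step. Qed.

Let face_dart O y : O \in fcs -> y \in O -> y \in darts (bip_adj S).
Proof. by rewrite inE => /andP[_ /subsetP]; apply. Qed.

Let face_eq O y : O \in fcs -> y \in O -> O = porbit face y.
Proof.
rewrite /fcs fcsE => /imsetP[z _ ->] yO; apply/eqP.
by rewrite eq_porbit_mem porbit_sym.
Qed.

Lemma face_rightP O j : O \in fcs -> j \in face_right O ->
  exists2 i, dart (i, j) \in O & i \in nu j /\ i \in face_left O.
Proof.
move=> OF; rewrite inE => /imsetP[[a b] yO /= E]; subst a.
have := face_dart OF yO; rewrite inE /=; case: b yO => // i yO ij.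
exists i; rewrite // !inE; split=> //; apply/imsetP.
exists (face (inr j, inl i)); first by rewrite face_stepE.
by rewrite (face1 rsig).
Qed.

(** Arriving from one neighbour, the face leaves to the next one in the rotation at [j]. The two
    differ, since a fixed dart would contradict transitivity on the two darts at [j]. *)
Lemma face_right_deg2 O j : O \in fcs -> j \in face_right O -> #|nu j| = 2 ->
  1 < #|nu j :&: face_left O|.
Proof.
move=> OF jO nj; have [i dO [inu iO]] := face_rightP OF jO.
pose y' := (face^-1)%g (dart (i, j)).
have fy' : face y' = dart (i, j) by rewrite permKV.
have y'O : y' \in O by rewrite -face_stepE // fy'.
have y'2 : y'.2 = inr j by rewrite -(face1 rsig) -/face fy'.
have := face_dart OF y'O; rewrite inE y'2.
case E: y'.1 => [i'|//] /= i'j.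
have i'O : i' \in face_left O by rewrite inE; apply/imsetP; exists y'.
have i'nu : i' \in nu j by rewrite inE.
have sig : sigma (inr j, inl i') = (inr j, inl i).
  by rewrite -[RHS]fy' /face faceE /swapd E y'2.
suff ne : i != i'.
  have <- : #|[set i; i']| = 2 by rewrite cards2 ne.
  apply: subset_leq_card; apply/subsetP=> k /set2P[->|->]; rewrite in_setI.
    by rewrite inu iO.
  by rewrite i'nu i'O.
apply/negP=> /eqP ii'; move: sig; rewrite -ii' => fx.
have [_ _ tr] := rsig.
have : nu j \subset [set i].
  apply/subsetP=> k knu; rewrite inE.
  have : (inr j, inl k) \in porbit sigma (inr j, inl i).
    by apply: tr; rewrite /=; move: knu inu; rewrite !inE.
  have : forall z, z \in porbit sigma (inr j, inl i) -> z = (inr j, inl i).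
    by apply: porbit_ind => // z _ ->.
  by move=> H /H [->].
by move/subset_leq_card; rewrite nj cards1.
Qed.

(** An open face has at most as many vertices as edges. With right degrees at most 2, the edges
    number at most the right vertices plus those of degree 2; the right vertices cancel. *)
Lemma face_left_le O : O \in fcs -> ~~ closed_face O ->
  (forall j, j \in face_right O -> #|nu j| <= 2) ->
  #|face_left O| <= #|[set j in face_right O | #|nu j| == 2]|.
Proof.
move=> OF nc small.
have := card_face_vertices (@bip_adj_sym S) (edge_seq_uniq S) (@bip_adjE S) rsig OF nc.
have -> : #|[set y.1 | y in O]| = #|face_left O| + #|face_right O|.
  set V := [set y.1 | y in O].
  rewrite -(cardsID [set x | if x is inl _ then true else false] V); congr (_ + _).
    rewrite -(card_imset (mem (face_left O)) (@inl_inj I1 I2)).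
    apply: eq_card => x; rewrite !inE; apply/andP/imsetP => [[xV]|[i]].
      by case: x xV => // i iV _; exists i; rewrite ?inE.
    by rewrite inE => iV ->.
  rewrite -(card_imset (mem (face_right O)) (@inr_inj I1 I2)).
  apply: eq_card => x; rewrite !inE; apply/andP/imsetP => [[]|[i]].
    by case: x => // i _ iV; exists i; rewrite ?inE.
  by rewrite inE => iV ->.
have le : count (fun e => (e \in O) || (swapd e \in O)) (edge_seq S) <=
    #|[set x in S | x.2 \in face_right O]|.
  rewrite count_map -size_filter cardE.
  apply: uniq_leq_size; first by rewrite filter_uniq ?enum_uniq.
  move=> [i j]; rewrite mem_filter !mem_enum !inE /= => /andP[ijO ->].
  apply/imsetP; case/orP: ijO => ijO; last by exists (inr j, inl i).
  by exists (face (inl i, inr j)); rewrite ?face_stepE // (face1 rsig).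
move=> /leq_trans/(_ le); rewrite card_edges.
have : \sum_(j in face_right O) #|nu j| <=
   #|face_right O| + #|[set j in face_right O | #|nu j| == 2]|.
  rewrite -!sum1_card [X in _ <= _ + X](eq_bigl (fun j => (j \in face_right O) && (#|nu j| == 2))); last first.
    by move=> j; rewrite inE.
  rewrite [X in _ <= _ + X]big_mkcondr -big_split /=; apply: leq_sum => j /small.
  by case: (#|nu j|) => [|[|[|]]].
by move=> H1 H2; have := leq_trans H2 H1; rewrite addnC leq_add2l.
Qed.

Lemma card_open_faces L :
  L * #|[set O in fcs | ~~ closed_face O]| <=
  L * (deg3_mass nu + dense_mass L nu) + 2 * num_deg2 nu.
Proof.
pose big O := [exists j in face_right O, 2 < #|nu j|].
pose J2 O := [set j in face_right O | #|nu j| == 2].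
pose N := [set O in fcs | ~~ closed_face O].
have Nbig : #|[set O in N | big O]| <= deg3_mass nu.
  rewrite /deg3_mass -card_edges.
  apply: leq_trans (leq_imset_card (fun x => porbit face (dart x)) _).
  apply: subset_leq_card; apply/subsetP=> O; rewrite !inE -!andbA => /and4P[OP OD _ bO].
  have OF : O \in fcs by rewrite inE OP.
  case/exists_inP: bO => j jO nj; have [i dO [inu _]] := face_rightP OF jO.
  by apply/imsetP; exists (i, j); [rewrite !inE nj andbT; move: inu; rewrite inE|apply: face_eq].
(* Double counting: each such face owns more than [L] darts leaving right vertices of degree 2, and
   faces are disjoint. *)
have Nlong : L * #|[set O in N | ~~ big O && (L < #|J2 O|)]| <= 2 * num_deg2 nu.
  have -> : 2 * num_deg2 nu = #|[set x in S | #|nu x.2| == 2]|.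
    rewrite (card_edges S (fun j => #|nu j| == 2)) mulnC -sum_nat_const.
    by rewrite (eq_bigl (fun j => #|nu j| == 2)) => [|j]; [apply: eq_bigr => j /eqP|rewrite inE].
  rewrite -sum1_card big_distrr /= -sum1_card.
  apply: leq_trans (_ : \sum_(O in fcs) \sum_(x in [set x in S | #|nu x.2| == 2]) (dart x \in O) <= _).
    rewrite big_mkcond [X in _ <= X]big_mkcond; apply: leq_sum => O _.
    rewrite [in X in X <= _]inE [_ \in N]inE; case: (boolP (O \in fcs)) => //= OF.
    case: ifP => // /and3P[_ _ long]; rewrite muln1; apply: ltnW; apply: leq_trans long _.
    rewrite -big_mkcondr /= sum1dep_card.
    have -> : J2 O = snd @: [set x | (x \in [set x in S | #|nu x.2| == 2]) && (dart x \in O)].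
      apply/setP=> j; rewrite inE; apply/andP/imsetP => [[jO nj]|[[i k]]].
        have [i dO [inu _]] := face_rightP OF jO.
        by exists (i, j); rewrite // !inE nj dO !andbT; move: inu; rewrite inE.
      rewrite !inE /= => /andP[/andP[_ nk] dO] ->; split=> //.
      by apply/imsetP; exists (dart (i, k)).
    exact: leq_imset_card.
  rewrite exchange_big /=; apply: leq_sum => x _.
  case: (pickP (fun O => (O \in fcs) && (dart x \in O))) => [ O /andP[OF xO]|no].
    rewrite (bigD1 O) //= xO big1 // => O' /andP[OF' neO]; case: (boolP (_ \in O')) => // xO'.
    by rewrite (face_eq OF xO) (face_eq OF' xO') eqxx in neO.
  by rewrite big1 // => O OF; have := no O; rewrite OF /= => ->.
have Nshort : #|[set O in N | ~~ big O && (#|J2 O| <= L)]| <= dense_mass L nu.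
  pose TT := [set t : ({set I1} * {set I2}) * (I1 * I2) |
     [&& 0 < #|t.1.1| <= L, dense_pair nu t.1, t.2.1 \in t.1.1 & t.2.2 \in t.1.2]].
  have -> : dense_mass L nu = #|TT|.
    rewrite -sum1_card (partition_big fst (fun P : {set I1} * {set I2} => (0 < #|P.1| <= L) && dense_pair nu P)) => [|t].
      apply: eq_bigr => P PP; rewrite -cardsX -sum1_card.
      rewrite (reindex_onto (fun x => (P, x)) snd) => [|[a b]] /=; last by case/andP => _ /eqP ->.
      by apply: eq_bigl => -[a b]; rewrite !inE /= !eqxx !andbT andbA PP.
    by rewrite inE => /and4P[-> ->].
  apply: leq_trans (leq_imset_card (fun t => porbit face (dart t.2)) _).
  apply: subset_leq_card; apply/subsetP=> O; rewrite in_set => /and3P[ON nb sh].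
  have /setIdP[OF nc] := ON.
  have small j : j \in face_right O -> #|nu j| <= 2.
    by move=> jO; rewrite leqNgt; apply: contra nb => ?; apply/exists_inP; exists j.
  have le := face_left_le OF nc small.
  have [z zO] : exists z, z \in O.
    by move: OF; rewrite /fcs fcsE => /imsetP[z _ ->]; exists z; apply: porbit_id.
  have [i iO] : exists i, i \in face_left O.
    have zD := face_dart OF zO; case E: z.1 => [i|j].
      by exists i; rewrite inE; apply/imsetP; exists z.
    have [|i _ [_ ?]] := @face_rightP O j OF; last by exists i.
    by rewrite inE; apply/imsetP; exists z.
  (* Only as many right vertices of degree 2 are kept as there are left vertices: balanced sides are
     what keeps the expected number of dense pairs bounded. *)
  have [J JJ2 cJ] : exists2 J : {set I2}, J \subset J2 O & #|J| = #|face_left O|.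
    have := le; set m := #|face_left O|; rewrite -/(J2 O) cardE => mle.
    exists [set j in take m (enum (J2 O))].
      by apply/subsetP=> j; rewrite inE => /mem_take; rewrite mem_enum.
    rewrite cardsE; have /card_uniqP -> : uniq (take m (enum (J2 O))) by rewrite take_uniq ?enum_uniq.
    by rewrite size_take; case: ltngtP mle.
  have l0 : 0 < #|face_left O| by apply/card_gt0P; exists i.
  have /card_gt0P[j jJ] : 0 < #|J| by rewrite cJ.
  have /(subsetP JJ2)/setIdP[jO /eqP nj] := jJ.
  have [k dO [knu kO]] := face_rightP OF jO.
  apply/imsetP; exists ((face_left O, J), (k, j)); last exact: face_eq.
  rewrite inE /= l0 (leq_trans le sh) kO jJ /dense_pair /= cJ eqxx !andbT /=.
  apply/forall_inP=> j' j'J; have /(subsetP JJ2)/setIdP[j'O /eqP nj'] := j'J.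
  exact: face_right_deg2.
rewrite -/N.
have -> : #|N| = #|[set O in N | big O]| + (#|[set O in N | ~~ big O && (L < #|J2 O|)]| +
   #|[set O in N | ~~ big O && (#|J2 O| <= L)]|).
  rewrite -(cardsID [set O | big O] N); congr (_ + _).
    by apply: eq_card => O; rewrite !inE.
  rewrite -(cardsID [set O | L < #|J2 O|] (N :\: _)); congr (_ + _).
    by apply: eq_card => O; rewrite !inE; case: (big O); case: (L < _); rewrite /= ?andbF ?andbT.
  apply: eq_card => O; rewrite !inE -leqNgt.
  by case: (big O); case: (_ <= L); rewrite /= ?andbF ?andbT.
rewrite !mulnDr [X in _ <= X]addnAC -[X in _ <= X]addnA; apply: leq_add.
  by rewrite leq_mul2l Nbig orbT.
by apply: leq_add => //; rewrite leq_mul2l Nshort orbT.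
Qed.
End Faces.
End Bipartite.

(** * Excess and tree components *)

Section Stars.
Variables (n1 n2 : nat).
Local Notation I1 := 'I_n1.
Local Notation I2 := 'I_n2.
Implicit Types (S : {set I1 * I2}) (nu : I2 -> {set I1}) (l : seq (I1 * I1)).

(** Contracting a right vertex of degree d > 0 trades its d edges for d - 1 edges that connect its
    neighbours. *)
Definition star (s : seq I1) : seq (I1 * I1) :=
  if s is i0 :: r then [seq (i0, i) | i <- r] else [::].

Definition star_on (js : seq I2) nu := flatten [seq star (enum (nu j)) | j <- js].

Definition star_seq nu := star_on (enum I2) nu.

(** The usual excess, edges minus vertices plus components, shifted by the number of vertices to
    stay in nat. *)
Definition excess l := size l + ncl l.

Lemma size_star s : size (star s) = (size s).-1.
Proof. by case: s => //= i s; rewrite size_map. Qed.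

Lemma size_star_on js nu : size (star_on js nu) = \sum_(j <- js) #|nu j|.-1.
Proof.
rewrite size_flatten /shape sumnE !big_map; apply: eq_bigr => j _.
by rewrite size_star cardE.
Qed.

Lemma mem_star_on js nu e : reflect (exists2 j, j \in js & e \in star (enum (nu j)))
  (e \in star_on js nu).
Proof. exact: flatten_mapP. Qed.

Lemma star_mem nu j e : e \in star (enum (nu j)) -> e.1 \in nu j /\ e.2 \in nu j.
Proof.
rewrite -[e.1 \in nu j]mem_enum -[e.2 \in nu j]mem_enum.
case: (enum _) => //= i s /mapP[k ks ->] /=.
by rewrite !inE eqxx ks orbT.
Qed.

Lemma star_uf l nu j i i' : {subset star (enum (nu j)) <= l} ->
  i \in nu j -> i' \in nu j -> uf l i = uf l i'.
Proof.
rewrite -[i \in nu j]mem_enum -[i' \in nu j]mem_enum.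
case: (enum _) => //= i0 s sl.
have H k : k \in i0 :: s -> uf l i0 = uf l k.
  rewrite inE => /predU1P[-> //|ks].
  by apply: (uf_edge (e := (i0, k))); apply: sl; apply: map_f.
by move=> /H <- /H <-.
Qed.

(** A new edge adds one to the size and removes at most one component. *)
Lemma excess_cat l1 l2 : excess l2 <= excess (l1 ++ l2) <= excess l2 + size l1.
Proof.
rewrite /excess size_cat; have := ncl_cat_size l1 l2.
have : ncl (l1 ++ l2) <= ncl l2.
  by apply: ncl_subset => x xl; rewrite mem_cat xl orbT.
card_lia.
Qed.

Lemma excess_perm l1 l2 : perm_eq l1 l2 -> excess l1 = excess l2.
Proof.
by move=> p; rewrite /excess (perm_size p) (ncl_eq_mem (perm_mem p)).
Qed.

Lemma star_on_filter (a : pred I2) js nu :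
  perm_eq (star_on js nu)
    (star_on (filter a js) nu ++ star_on (filter (predC a) js) nu).
Proof.
rewrite /star_on -flatten_cat -map_cat; apply: perm_flatten; apply: perm_map.
by rewrite perm_sym (permEl (perm_filterC a js)).
Qed.

(** Hanging every non-isolated right vertex on the centre of its star gives a graph with the same
    components as the bipartite graph. *)
Definition pendant nu j : seq ((I1 + I2) * (I1 + I2)) :=
  if enum (nu j) is i0 :: _ then [:: (inr j, inl i0)] else [::].

Definition pendants nu js := flatten [seq pendant nu j | j <- js].

Definition inl_seq l : seq ((I1 + I2) * (I1 + I2)) := [seq (inl x.1, inl x.2) | x <- l].

Lemma uf_inl_seq l : (forall i, uf (inl_seq l) (inl i) = inl (uf l i)) /\
  (forall j, uf (inl_seq l) (inr j) = inr j).
Proof.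
elim: l => //= e l [IH1 IH2]; split => [i|j]; rewrite !IH1 ?IH2 //.
by rewrite (inj_eq inl_inj); case: ifP.
Qed.

Lemma ncl_inl_seq l : ncl (inl_seq l) = n2 + ncl l.
Proof.
have [H1 H2] := uf_inl_seq l.
pose A : {set I1 + I2} := inr @: [set: I2].
pose B : {set I1 + I2} := inl @: (uf l @: [set: I1]).
have cA : #|A| = n2 by rewrite card_imset ?cardsT ?card_ord //; apply: inr_inj.
have cB : #|B| = ncl l by rewrite card_imset //; apply: inl_inj.
transitivity (#|B| + #|A|); last by rewrite cA cB addnC.
have /leqifP := leq_card_setU B A; rewrite (_ : [disjoint B & A]); last first.
  rewrite -setI_eq0; apply/eqP/setP=> x; rewrite !inE.
  by apply/negP=> /andP[/imsetP[i _ ->] /imsetP[j _]].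
move=> /eqP <-; apply: eq_card => x; rewrite inE.
apply/imsetP/orP => [[[i|j] _ ->]|[/imsetP[_ /imsetP[i _ ->] ->]|/imsetP[j _ ->]]].
- by left; rewrite H1 imset_f // imset_f.
- by right; rewrite H2 imset_f.
- by exists (inl i).
- by exists (inr j).
Qed.

Lemma ncl_pendants nu l js : uniq js ->
  ncl (pendants nu js ++ inl_seq l) + size (pendants nu js) = n2 + ncl l.
Proof.
move=> ujs; rewrite -ncl_inl_seq.
(* The induction must also know that left representatives never change and that right vertices not
   yet treated are singletons, so that each pendant edge joins two classes. *)
suff: (forall i, uf (pendants nu js ++ inl_seq l) (inl i) = inl (uf l i)) /\
  (forall j, j \notin js -> uf (pendants nu js ++ inl_seq l) (inr j) = inr j) /\
  ncl (pendants nu js ++ inl_seq l) + size (pendants nu js) = ncl (inl_seq l).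
  by case=> _ [].
have [H1 H2] := uf_inl_seq l.
elim: js ujs => [_|j js IH] /=; first by rewrite addn0.
rewrite /pendants /= -/(pendants nu js) /pendant.
case/andP => jjs /IH[IH1 [IH2 IH3]]; case: (enum _) => [|i0 r] /=.
  by split=> //; split=> // j'; rewrite inE negb_or => /andP[_ /IH2].
rewrite (IH2 j jjs); split=> [i|]; first by rewrite !IH1.
split=> [j'|].
  by rewrite inE negb_or => /andP[jj' /IH2 ->]; rewrite (inj_eq inr_inj) (negPf jj').
have := ncl_cons (inr j, inl i0) (pendants nu js ++ inl_seq l).
rewrite /= IH1 IH2 //=; move: IH3; card_lia.
Qed.

Lemma excess_edge_seq S :
  size (edge_seq S) + ncl (edge_seq S) = n2 + excess (star_seq (nbr S)).
Proof.
set nu := nbr S.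
have -> : ncl (edge_seq S) = ncl (pendants nu (enum I2) ++ inl_seq (star_seq nu)).
  apply: ncl_eq => e; set l := (X in uf X).
    case/edge_seqP => -[i j] /= ij -> /=.
    have inu : i \in nu j by rewrite inE.
    case E: (enum (nu j)) => [|i0 r]; first by rewrite -mem_enum E in inu.
    have -> : uf l (inr j) = uf l (inl i0).
      apply: (uf_edge (e := (inr j, inl i0))); rewrite mem_cat; apply/orP; left.
      by apply/flatten_mapP; exists j; rewrite ?mem_enum // /pendant E mem_head.
    move: inu; rewrite -mem_enum E inE => /predU1P[-> //|ir].
    apply/esym; apply: (uf_edge (e := (inl i0, inl i))); rewrite mem_cat; apply/orP; right.
    apply/mapP; exists (i0, i) => //; apply/mem_star_on; exists j; rewrite ?mem_enum //.
    by rewrite E /=; apply: map_f.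
  have H i j : i \in nu j -> uf l (inl i) = uf l (inr j).
    by rewrite inE => ij; apply: (uf_edge (e := (inl i, inr j))); rewrite mem_edge_seq.
  rewrite mem_cat => /orP[/flatten_mapP[j _]|/mapP[[a b] /mem_star_on[j _ /star_mem[aj bj]] ->]].
    rewrite /pendant; case E: (enum (nu j)) => [//|i0 r]; rewrite inE => /eqP ->.
    by apply/esym/H; rewrite -mem_enum E mem_head.
  by rewrite /= !(H _ j).
have := ncl_pendants nu (star_seq nu) (enum_uniq I2).
suff -> : size (edge_seq S) = size (star_seq nu) + size (pendants nu (enum I2)).
  rewrite /excess; card_lia.
rewrite size_edge_seq size_star_on size_flatten /shape sumnE !big_map -big_split /=.
rewrite -enumT big_enum /=; apply: eq_bigr => j _; rewrite /pendant cardE.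
by case: (enum _) => //= i r; rewrite addn1.
Qed.

(* The graph on the left vertices whose edges are the right vertices of degree two. *)
Definition pair_seq nu := star_on [seq j <- enum I2 | #|nu j| == 2] nu.

Lemma size_pair_seq nu : size (pair_seq nu) = num_deg2 nu.
Proof.
rewrite /num_deg2 size_star_on big_filter -sum1_card big_enum_cond; apply: eq_big => j.
  by rewrite inE.
by move/eqP=> ->.
Qed.

(** Right vertices of degree below 2 have empty stars, and those of degree at least 3 have fewer
    star edges than their degree. *)
Lemma excess_pair_seq nu : num_deg2 nu + ncl (pair_seq nu) <= excess (star_seq nu)
  <= num_deg2 nu + ncl (pair_seq nu) + deg3_mass nu.
Proof.
rewrite -size_pair_seq -/(excess (pair_seq nu)).
set l1 := star_on [seq j <- enum I2 | #|nu j| != 2] nu.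
have -> : excess (star_seq nu) = excess (l1 ++ pair_seq nu).
  apply: excess_perm; apply: perm_trans (permEl (perm_catC _ _)).
  exact: (star_on_filter (fun j => #|nu j| == 2)).
have /andP[-> /leq_trans] := excess_cat l1 (pair_seq nu); apply; rewrite leq_add2l.
rewrite size_star_on big_filter big_enum_cond /deg3_mass big_mkcond [X in _ <= X]big_mkcond /=.
by apply: leq_sum => j _; case: (#|nu j|) => [|[|[|m]]] //=.
Qed.

(** Emptying [j] deletes one star. This is the bounded increment that the variance estimate
    needs. *)
Lemma excess_remove nu nu' j : (forall j', j' != j -> nu' j' = nu j') -> nu' j = set0 ->
  excess (star_seq nu') <= excess (star_seq nu) <= excess (star_seq nu') + #|nu j|.-1.
Proof.
move=> eqn nj0.
have E m : excess (star_seq m) = excess (star (enum (m j)) ++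
    star_on (filter (predC (pred1 j)) (enum I2)) m).
  rewrite (excess_perm (star_on_filter (pred1 j) _ m)); congr (excess (_ ++ _)).
  by rewrite filter_pred1_uniq ?enum_uniq ?mem_enum // /star_on /= cats0.
rewrite !E nj0 enum_set0 /= (_ : star_on _ nu' = star_on (filter (predC (pred1 j)) (enum I2)) nu).
  have /andP[-> /leq_trans] := excess_cat (star (enum (nu j)))
    (star_on (filter (predC (pred1 j)) (enum I2)) nu).
  by apply; rewrite size_star cardE.
rewrite /star_on; congr flatten; apply/eq_in_map => j'.
by rewrite mem_filter /= => /andP[/eqn ->].
Qed.

Definition touching nu (C : {set I1}) := [set j | (#|nu j| == 2) && (nu j :&: C != set0)].

Definition classes nu := preim_partition (uf (pair_seq nu)) [set: I1].

(** A class is connected, so having fewer edges than vertices makes it a tree. *)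
Definition tree_class nu C := (C \in classes nu) && (#|touching nu C| < #|C|).

Definition num_trees k nu := #|[set C : {set I1} | tree_class nu C && (#|C| == k)]|.

Lemma classesP nu C : reflect (exists x, C = [set y | uf (pair_seq nu) x == uf (pair_seq nu) y])
  (C \in classes nu).
Proof.
apply: (iffP imsetP) => [[x _ ->]|[x ->]]; exists x => //; apply/setP=> y; rewrite !inE //.
Qed.

Lemma card_classes nu : #|classes nu| = ncl (pair_seq nu).
Proof.
rewrite /classes /preim_partition /equivalence_partition.
apply/eqP; rewrite eqn_leq; apply/andP; split; apply: card_imset_kernel => a b _ _.
  by move=> E; apply/setP=> y; rewrite !inE E.
by move/setP/(_ b); rewrite !inE eqxx => /eqP.
Qed.

Lemma sum_card_classes nu : \sum_(C in classes nu) #|C| = n1.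
Proof.
rewrite -(card_partition (preim_partitionP _ _)) cardsT card_ord //.
Qed.

Lemma sum_num_trees K nu (F : nat -> nat) :
  \sum_(k < K.+1) F k * num_trees k nu =
  \sum_(C : {set I1} | tree_class nu C && (#|C| <= K)) F #|C|.
Proof.
rewrite (partition_big (fun C : {set I1} => inord #|C|) (fun _ : 'I_K.+1 => true)) //=.
apply: eq_bigr => k _; rewrite mulnC -sum_nat_const.
apply: eq_big => C; last by rewrite inE => /andP[_ /eqP ->].
rewrite inE -andbA; congr (_ && _); apply/idP/andP => [/eqP ->|[le /eqP <-]].
  by rewrite -ltnS ltn_ord inord_val.
by rewrite inordK.
Qed.

Lemma sum_trees_le K nu : \sum_(k < K.+1) num_trees k nu <= ncl (pair_seq nu).
Proof.
rewrite (eq_bigr (fun k : 'I_K.+1 => 1 * num_trees k nu)) => [|k _]; last by rewrite mul1n.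
rewrite (sum_num_trees K nu (fun _ => 1)) sum1_card -card_classes.
by apply: subset_leq_card; apply/subsetP=> C /andP[/andP[]].
Qed.

Lemma sum_trees_size_le K nu : \sum_(k < K.+1) k * num_trees k nu <= n1.
Proof.
rewrite (sum_num_trees K nu id) -[X in _ <= X](sum_card_classes nu).
rewrite big_mkcond [X in _ <= X]big_mkcond; apply: leq_sum => C _.
by rewrite /tree_class; case: (C \in _) => //=; case: ifP.
Qed.

Lemma class_pair nu C j : C \in classes nu -> j \in touching nu C -> nu j \subset C.
Proof.
case/classesP=> x ->; rewrite inE => /andP[nj /set0Pn[i]].
rewrite !inE => /andP[inu /eqP xi]; apply/subsetP=> i' i'nu; rewrite inE xi; apply/eqP.
apply: star_uf inu i'nu => e ej; apply/mem_star_on; exists j => //.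
by rewrite mem_filter nj mem_enum.
Qed.

(** Components with more than [K] vertices number at most n1 / K. A smaller one that is not a tree
    has at least as many edges as vertices and, after trimming its edges, is a dense pair. *)
Lemma ncl_pair_seq_le K nu : K * ncl (pair_seq nu) <=
  K * (\sum_(k < K.+1) num_trees k nu + dense_mass K nu) + n1.
Proof.
rewrite (eq_bigr (fun k : 'I_K.+1 => 1 * num_trees k nu)) => [|k _]; last by rewrite mul1n.
rewrite (sum_num_trees K nu (fun _ => 1)) sum1_card -card_classes.
rewrite -(cardsID [set C : {set I1} | #|C| <= K]) mulnDr leq_add //; last first.
  rewrite -[X in _ <= X](sum_card_classes nu) mulnC -sum_nat_const big_mkcond [X in _ <= X]big_mkcond.
  apply: leq_sum => C _; rewrite !inE -ltnNge andbC; case: (C \in _) => //=.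
  by case: ltnP => // /ltnW.
rewrite leq_mul2l; apply/orP; right.
rewrite -(cardsID [set C : {set I1} | #|touching nu C| < #|C|]) leq_add //.
  by apply: subset_leq_card; apply/subsetP=> C; rewrite !inE => /andP[/andP[Cc CK] Ct]; rewrite unfold_in /tree_class CK Cc Ct.
pose DP := [set P : {set I1} * {set I2} | (0 < #|P.1| <= K) && dense_pair nu P].
apply: (@leq_trans #|DP|); last first.
  rewrite -sum1_card /dense_mass [X in X <= _](eq_bigl (fun P : {set I1} * {set I2} => (0 < #|P.1| <= K) && dense_pair nu P)).
    apply: leq_sum => P /andP[/andP[P1 _] /andP[/eqP <- _]]; rewrite muln_gt0 P1 //.
  by move=> P; rewrite inE.
apply: leq_trans (leq_imset_card fst _); apply: subset_leq_card; apply/subsetP=> C.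
rewrite !inE -leqNgt => /andP[Ct /andP[CC CK]].
have [J JJ2 cJ] : exists2 J : {set I2}, J \subset touching nu C & #|J| = #|C|.
  have := Ct; set m := #|C|; rewrite cardE => mle.
  exists [set j in take m (enum (touching nu C))].
    by apply/subsetP=> j; rewrite inE => /mem_take; rewrite mem_enum.
  rewrite cardsE; have /card_uniqP -> : uniq (take m (enum (touching nu C))) by rewrite take_uniq ?enum_uniq.
  by rewrite size_take; case: ltngtP mle.
apply/imsetP; exists (C, J) => //; rewrite inE /= CK andbT /dense_pair /= cJ eqxx.
apply/andP; split.
  by case/classesP: CC => x ->; apply/card_gt0P; exists x; rewrite inE.
apply/forall_inP=> j /(subsetP JJ2) jt; have := class_pair CC jt.
by move: jt; rewrite inE => /andP[/eqP nj _] /setIidPl ->; rewrite nj.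
Qed.

(** Every edge of the list joins two classes, so none closes a cycle. *)
Definition acyclic l := ncl l + size l == n1.

(* Outside a set [C] containing the edges of [l], all classes are singletons. *)
Lemma ncl_split l (C : {set I1}) : (forall e, e \in l -> e.1 \in C /\ e.2 \in C) ->
  ncl l + #|C| = #|uf l @: C| + n1.
Proof.
move=> lC; rewrite /ncl -{1}(setUCr C) imsetU.
have un x y : x \in C -> y \notin C -> uf l x != uf l y.
  move=> xC yC; apply: contra yC => /eqP/(uf_univ (g := fun z => z \in C)) H; rewrite -H // => e.
  by move=> /lC[-> ->].
have /leqifP := leq_card_setU (uf l @: C) (uf l @: ~: C).
rewrite (_ : [disjoint _ & _]); last first.
  rewrite -setI_eq0; apply/eqP/setP=> t; rewrite !inE; apply/negP=> /andP[/imsetP[x xC ->]].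
  by case/imsetP=> y; rewrite inE => /(un _ _ xC)/eqP.
move=> /eqP ->; rewrite -addnA; congr (_ + _).
suff -> : #|uf l @: ~: C| = #|~: C| by rewrite addnC cardsC card_ord.
apply: card_in_imset.
move=> x y; rewrite !inE => xC yC.
move/(uf_univ (g := fun z => if z \in C then None else Some z)); rewrite (negPf xC) (negPf yC).
move=> H; have {}H : Some x = Some y by apply: H => e /lC[-> ->].
by case: H.
Qed.

Lemma size_pairs_on (J : {set I2}) nu : {in J, forall j, #|nu j| = 2} ->
  size (star_on (enum J) nu) = #|J|.
Proof.
move=> H; rewrite size_star_on -sum1_card big_enum; apply: eq_bigr => j /H -> //.
Qed.

(** The right side no longer mentions the global partition: it depends on which right vertices touch
    [C] and on their neighbourhoods, so its expectation can be taken one right vertex at a time. *)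
Lemma tree_classP nu (C : {set I1}) : 0 < #|C| ->
  tree_class nu C =
  [&& #|touching nu C| == #|C|.-1, [forall j in touching nu C, nu j \subset C] &
      acyclic (star_on (enum (touching nu C)) nu)].
Proof.
move=> C0; set J := touching nu C; set l1 := star_on _ nu.
have J2 : {in J, forall j, #|nu j| = 2} by move=> j; rewrite inE => /andP[/eqP].
have sl1 : size l1 = #|J| := size_pairs_on J2.
have sub : {subset l1 <= pair_seq nu}.
  move=> e /mem_star_on[j jJ ej]; apply/mem_star_on; exists j => //.
  by move: jJ; rewrite mem_enum mem_filter mem_enum => /J2 ->.
rewrite /acyclic sl1; apply/andP/and3P => [[CC lt]|[/eqP cJ /forall_inP JC /eqP ac]].
  have JC j : j \in J -> nu j \subset C := class_pair CC.
  case/classesP: (CC) => x EC.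
  (* The invariant is the class under [l1] on [C] and [None] outside: an edge that does not touch
     [C] has both ends outside. *)
  have con y : y \in C -> uf l1 y = uf l1 x.
    move=> yC; have := yC; rewrite {1}EC inE => /eqP.
    move/(uf_univ (g := fun z => if z \in C then Some (uf l1 z) else None)).
    have -> : x \in C by rewrite EC inE.
    rewrite yC => H; suff E : Some (uf l1 x) = Some (uf l1 y) by case: E.
    apply: H => e /mem_star_on[j]; rewrite mem_filter => /andP[nj _] ej.
    have [e1 e2] := star_mem ej; case: (boolP (j \in J)) => jJ.
      rewrite !(subsetP (JC _ jJ)) //; congr Some; apply: star_uf e1 e2 => f fj.
      by apply/mem_star_on; exists j; rewrite ?mem_enum.
    move: jJ; rewrite inE nj negbK => /eqP/setP H.
    by have := H e.1; have := H e.2; rewrite !inE e1 e2 /= => -> ->.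
  have := ncl_connected con; have := ncl_size l1; rewrite sl1 card_ord.
  move=> H1 H2; split; [|by apply/forall_inP|].
    by apply/eqP; move: H1 H2 lt; card_lia.
  by apply/eqP; move: H1 H2 lt; card_lia.
have l1C e : e \in l1 -> e.1 \in C /\ e.2 \in C.
  move=> /mem_star_on[j]; rewrite mem_enum => jJ /star_mem[e1 e2].
  by split; apply: (subsetP (JC j jJ)).
split; last by rewrite cJ; case: #|C| C0.
have /card_gt0P[x xC] := C0.
(* An acyclic list of |C| - 1 edges inside [C] leaves one class on [C]. *)
have /cards1P[t Et] : #|uf l1 @: C| == 1.
  by have := ncl_split l1C; move: ac cJ C0; card_lia.
have con y : y \in C -> uf l1 y = uf l1 x.
  move=> yC; have : uf l1 y \in uf l1 @: C by rewrite imset_f.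
  have : uf l1 x \in uf l1 @: C by rewrite imset_f.
  by rewrite Et !inE => /eqP -> /eqP ->.
apply/classesP; exists x; apply/setP=> y; rewrite inE; apply/idP/eqP => [/con|].
  by move/(uf_subset sub).
move/(uf_univ (g := fun z => z \in C)) => <- // e /mem_star_on[j].
rewrite mem_filter => /andP[nj _] /star_mem[e1 e2].
case: (boolP (j \in J)) => jJ; first by rewrite !(subsetP (JC _ jJ)).
move: jJ; rewrite inE nj negbK => /eqP/setP H.
by have := H e.1; have := H e.2; rewrite !inE e1 e2 /= => -> ->.
Qed.
End Stars.

(** Euler's formula for a rotation system of least genus: the faces number at least the components,
    and at most the components plus the open faces bounded by [card_open_faces]. *)
Lemma genus_bounds n1 n2 (S : {set 'I_n1 * 'I_n2}) L :
  let nu := nbr S in let h := excess (star_seq nu) in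
  exists2 g, is_genus (bip_adj S) g &
    2 * g + n1 <= h /\
    L * h <= L * (2 * g + n1 + deg3_mass nu + dense_mass L nu) + 2 * num_deg2 nu.
Proof.
move=> nu h; have sy := @bip_adj_sym _ _ S; have lE := @bip_adjE _ _ S.
have ul := edge_seq_uniq S; have sl := @edge_seq_swap _ _ S.
pose P g := `[< exists2 sigma, rotation_system (bip_adj S) sigma & rs_genus (bip_adj S) sigma g >].
have exP : exists g, P g.
  have [sigma rs] := rotation_system_exists (bip_adj S).
  have [g eg] := euler_formula sy ul sl lE rs.
  by exists g; apply/asboolP; exists sigma => //; apply/(rs_genusE ul sl lE).
case: (ex_minnP exP) => g /asboolP[sigma rs gs] gmin; exists g.
  split; first by exists sigma.
  by move=> sigma' h' rs' gs'; apply: gmin; apply/asboolP; exists sigma'.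
move/(rs_genusE ul sl lE): gs.
have := ncl_le_num_faces sy lE rs; have := num_faces_le sy lE rs.
have := card_open_faces rs L; have := excess_edge_seq S.
rewrite card_sum !card_ord -/nu -/h.
set N := #|_|; set F := num_faces _ _; set c := ncl _; set E := size _.
set X := deg3_mass _; set Y := dense_mass _ _; set Z := num_deg2 _.
move=> H1 H2 H3 H4 H5; have le : h <= 2 * g + n1 + N by clearbody h N F c E X Y Z; lia.
split; first by clearbody h N F c E X Y Z; lia.
apply: leq_trans (_ : L * (2 * g + n1) + L * N <= _); first by rewrite -mulnDr leq_mul2l le orbT.
by rewrite -[_ + X + Y]addnA [X in _ <= X + _]mulnDr -addnA leq_add2l.
Qed.

(** * Product measures and the Efron-Stein inequality *)

Local Open Scope ring_scope.

Section ProductExpectation.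
Variables (R : realFieldType) (J Om : finType) (w : Om -> R).
Hypothesis w_ge0 : forall o, 0 <= w o.
Hypothesis w_sum : \sum_o w o = 1.
Implicit Types (nu : {ffun J -> Om}) (f g : {ffun J -> Om} -> R) (j : J).

Definition expect f := \sum_(nu : {ffun J -> Om}) (\prod_j w (nu j)) * f nu.

Definition upd nu j o : {ffun J -> Om} := [ffun j' => if j' == j then o else nu j'].

(** The conditional expectation given all coordinates other than [j]. *)
Definition avg j f nu := \sum_o w o * f (upd nu j o).

Definition indep j f := forall nu o, f (upd nu j o) = f nu.

Lemma updE nu j o : upd nu j o j = o.
Proof. by rewrite ffunE eqxx. Qed.

Lemma upd_neq nu j o j' : j' != j -> upd nu j o j' = nu j'.
Proof. by move=> ne; rewrite ffunE (negPf ne). Qed.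

Lemma upd_upd nu j o o' : upd (upd nu j o) j o' = upd nu j o'.
Proof. by apply/ffunP=> k; rewrite !ffunE; case: eqP. Qed.

Lemma upd_id nu j : upd nu j (nu j) = nu.
Proof. by apply/ffunP=> k; rewrite !ffunE; case: eqP => [->|]. Qed.

Lemma upd_comm nu i j o o' : i != j -> upd (upd nu i o) j o' = upd (upd nu j o') i o.
Proof.
move=> ij; apply/ffunP=> k; rewrite !ffunE.
by case: (altP (k =P j)) => // ->; rewrite eq_sym (negPf ij).
Qed.

Lemma eq_expect f g : f =1 g -> expect f = expect g.
Proof. by move=> fg; apply: eq_bigr => nu _; rewrite fg. Qed.

Lemma expectD f g : expect (fun nu => f nu + g nu) = expect f + expect g.
Proof. by rewrite -big_split; apply: eq_bigr => nu _; rewrite mulrDr. Qed.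

Lemma expectZ a f : expect (fun nu => a * f nu) = a * expect f.
Proof. by rewrite big_distrr; apply: eq_bigr => nu _; rewrite mulrCA. Qed.

Lemma expectB f g : expect (fun nu => f nu - g nu) = expect f - expect g.
Proof.
rewrite -[- expect g]mulN1r -expectZ -expectD.
by apply: eq_expect => nu; rewrite mulN1r.
Qed.

Lemma expect_sum (I : finType) (P : pred I) (F : I -> {ffun J -> Om} -> R) :
  expect (fun nu => \sum_(i | P i) F i nu) = \sum_(i | P i) expect (F i).
Proof. by rewrite exchange_big; apply: eq_bigr => nu _; rewrite big_distrr. Qed.

Lemma prod_w_ge0 nu : 0 <= \prod_j w (nu j).
Proof. by apply: prodr_ge0. Qed.

Lemma expect_le f g : (forall nu, f nu <= g nu) -> expect f <= expect g.
Proof. by move=> fg; apply: ler_sum => nu _; apply: ler_wpM2l => //; apply: prod_w_ge0. Qed.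

Lemma expect_ge0 f : (forall nu, 0 <= f nu) -> 0 <= expect f.
Proof. by move=> f0; apply: sumr_ge0 => nu _; apply: mulr_ge0 => //; apply: prod_w_ge0. Qed.

Lemma prod_w_upd nu j o :
  (\prod_i w (upd nu j o i)) * w (nu j) = (\prod_i w (nu i)) * w o.
Proof.
rewrite (bigD1 j) //= [in RHS](bigD1 j) //= updE.
rewrite (eq_bigr (fun i => w (nu i))) => [|i ij]; last by rewrite upd_neq.
by rewrite mulrAC [in RHS]mulrAC [w o * _]mulrC.
Qed.

(* Swapping the value at [j] with an independent copy preserves the measure. *)
Lemma expect_avg j f : expect (avg j f) = expect f.
Proof.
rewrite /expect /avg.
have -> : \sum_(nu : {ffun J -> Om}) (\prod_i w (nu i)) * f nu =
    \sum_(x : {ffun J -> Om} * Om) (\prod_i w (x.1 i)) * w x.2 * f x.1.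
  rewrite -(pair_bigA _ (fun nu o => \prod_i w (nu i) * w o * f nu)) /=.
  apply: eq_bigr => nu _; rewrite -[LHS]mulr1 -w_sum big_distrr /=.
  by apply: eq_bigr => o _; rewrite mulrAC.
pose sw (x : {ffun J -> Om} * Om) := (upd x.1 j x.2, x.1 j).
have swK : involutive sw.
  by case=> nu o; rewrite /sw /= upd_upd upd_id updE.
rewrite (reindex_inj (inv_inj swK)) /=.
under [RHS]eq_bigr => x _ do rewrite prod_w_upd.
rewrite -(pair_bigA _ (fun nu o => \prod_i w (nu i) * w o * f (upd nu j o))) /=.
by apply: eq_bigr => nu _; rewrite big_distrr /=; apply: eq_bigr => o _; rewrite mulrA.
Qed.

Lemma expect_cst a : expect (fun=> a) = a.
Proof.
rewrite /expect -big_distrl /= -(bigA_distr_bigA (fun=> w)) /=.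
by rewrite big1 ?mul1r.
Qed.

Lemma avg_mulr j f g : indep j g -> avg j (fun nu => f nu * g nu) =1 (fun nu => avg j f nu * g nu).
Proof.
move=> ig nu; rewrite /avg big_distrl /=; apply: eq_bigr => o _.
by rewrite ig mulrA.
Qed.

Lemma indep_avg j f : indep j (avg j f).
Proof. by move=> nu o; apply: eq_bigr => o' _; rewrite upd_upd. Qed.

Lemma avg_indep j f : indep j f -> avg j f =1 f.
Proof.
move=> fi nu; rewrite /avg (eq_bigr (fun o => w o * f nu)) => [|o _]; last by rewrite fi.
by rewrite -big_distrl /= w_sum mul1r.
Qed.

Lemma expect_indep j (phi : Om -> R) g : indep j g ->
  expect (fun nu => phi (nu j) * g nu) = (\sum_o w o * phi o) * expect g.
Proof.
move=> ig; rewrite -(expect_avg j) (eq_expect (avg_mulr _ ig)) -expectZ.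
apply: eq_expect => nu; congr (_ * _).
by apply: eq_bigr => o _; rewrite updE.
Qed.

Lemma expect_marginal j (phi : Om -> R) :
  expect (fun nu => phi (nu j)) = \sum_o w o * phi o.
Proof.
rewrite -[RHS]mulr1 -(expect_cst 1) -(expect_indep (j := j)) //.
by apply: eq_expect => nu; rewrite mulr1.
Qed.

Lemma expect_prod (s : seq J) (phi : Om -> R) : uniq s ->
  expect (fun nu => \prod_(j <- s) phi (nu j)) = (\sum_o w o * phi o) ^+ size s.
Proof.
elim: s => [_|j s IH] /=.
  by rewrite expr0 -[RHS]expect_cst; apply: eq_expect => nu; rewrite big_nil.
case/andP=> js us; rewrite exprS -IH // -(expect_indep (j := j)) => [|nu o].
  by apply: eq_expect => nu; rewrite big_cons.
apply: eq_big_seq => i si; rewrite upd_neq //.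
by apply: contraNneq js => <-.
Qed.

(** Pythagoras: [avg j] is an orthogonal projection. *)
Lemma expect_sqr_avg j f :
  expect (fun nu => (f nu - avg j f nu) ^+ 2) =
  expect (fun nu => f nu ^+ 2) - expect (fun nu => avg j f nu ^+ 2).
Proof.
have E : expect (fun nu => f nu * avg j f nu) = expect (fun nu => avg j f nu ^+ 2).
  by rewrite -(expect_avg j) (eq_expect (avg_mulr _ (@indep_avg j f))).
transitivity (expect (fun nu => f nu ^+ 2) - 2 * expect (fun nu => f nu * avg j f nu)
   + expect (fun nu => avg j f nu ^+ 2)); last by rewrite E; ring.
rewrite -expectZ -expectB -expectD; apply: eq_expect => nu; ring.
Qed.

Lemma expect_sqr_avg_le j f : expect (fun nu => avg j f nu ^+ 2) <= expect (fun nu => f nu ^+ 2).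
Proof.
rewrite -subr_ge0 -expect_sqr_avg; apply: expect_ge0 => nu; apply: sqr_ge0.
Qed.

Lemma avg_comm i j f : avg i (avg j f) =1 avg j (avg i f).
Proof.
case: (altP (i =P j)) => [-> //|ij] nu; rewrite /avg.
transitivity (\sum_o \sum_o' w o * (w o' * f (upd (upd nu i o) j o'))).
  by apply: eq_bigr => o _; rewrite big_distrr.
rewrite exchange_big; apply: eq_bigr => o _; rewrite big_distrr; apply: eq_bigr => o' _ /=.
by rewrite upd_comm // mulrCA.
Qed.

Lemma eq_avg j f g : f =1 g -> avg j f =1 avg j g.
Proof. by move=> fg nu; apply: eq_bigr => o _; rewrite fg. Qed.

Lemma avgB j f g : avg j (fun nu => f nu - g nu) =1 (fun nu => avg j f nu - avg j g nu).
Proof. by move=> nu; rewrite /avg -sumrB; apply: eq_bigr => o _; rewrite mulrBr. Qed.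

Definition avgs (s : seq J) f := foldr avg f s.

Lemma avgs_avg s j f : avgs s (avg j f) =1 avg j (avgs s f).
Proof.
elim: s => //= i s IH nu; rewrite (eq_avg i IH) avg_comm //.
Qed.

Lemma avgsB s f g : avgs s (fun nu => f nu - g nu) =1 (fun nu => avgs s f nu - avgs s g nu).
Proof. by elim: s => //= j s IH nu; rewrite (eq_avg j IH) avgB. Qed.

Lemma expect_sqr_avgs_le s f :
  expect (fun nu => avgs s f nu ^+ 2) <= expect (fun nu => f nu ^+ 2).
Proof. by elim: s => //= j s IH; apply: le_trans (expect_sqr_avg_le _ _) IH. Qed.

Lemma expect_avgs s f : expect (avgs s f) = expect f.
Proof. by elim: s => //= j s IH; rewrite expect_avg. Qed.

Lemma avgs_agree s f nu nu' : (forall j, j \notin s -> nu j = nu' j) ->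
  avgs s f nu = avgs s f nu'.
Proof.
elim: s nu nu' => [|j s IH] nu nu' H /=.
  by congr f; apply/ffunP=> j; apply: H.
apply: eq_bigr => o _; congr (_ * _); apply: IH => k ks; rewrite !ffunE.
by case: eqP => // kj; apply: H; rewrite inE negb_or ks andbT; apply/eqP.
Qed.

(* Efron-Stein: averaging over one coordinate at a time, each averaging loses in second moment
   at most what it would lose on [f] itself, as averagings commute and contract. *)
Theorem efron_stein f (h : J -> {ffun J -> Om} -> R) :
  (forall j, indep j (h j)) ->
  expect (fun nu => (f nu - expect f) ^+ 2) <= \sum_j expect (fun nu => (f nu - h j nu) ^+ 2).
Proof.
move=> hi.
have step s : expect (fun nu => f nu ^+ 2) - expect (fun nu => avgs s f nu ^+ 2) <=
    \sum_(j <- s) expect (fun nu => (f nu - avg j f nu) ^+ 2).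
  elim: s => [|j s IH] /=; first by rewrite big_nil subrr.
  rewrite big_cons; apply: le_trans (lerD (_ : _ - _ <= _) IH); last first.
    apply: le_trans (_ : expect (fun nu => avgs s (fun nu => f nu - avg j f nu) nu ^+ 2) <= _).
      apply: (_ : expect (fun nu => avgs s f nu ^+ 2) - expect (fun nu => avg j (avgs s f) nu ^+ 2) <= _).
      rewrite -expect_sqr_avg le_eqVlt; apply/orP; left; apply/eqP; apply: eq_expect => nu.
      by rewrite avgsB avgs_avg.
    exact: expect_sqr_avgs_le.
  by rewrite le_eqVlt; apply/orP; left; apply/eqP; ring.
have full : forall nu, avgs (enum J) f nu = expect f.
  move=> nu; rewrite -(expect_avgs (enum J)) -[LHS]expect_cst; apply: eq_expect => nu'.
  by apply: avgs_agree => j; rewrite mem_enum.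
have -> : expect (fun nu => (f nu - expect f) ^+ 2) =
    expect (fun nu => f nu ^+ 2) - expect (fun nu => avgs (enum J) f nu ^+ 2).
  rewrite (@eq_expect (fun nu => avgs (enum J) f nu ^+ 2) (fun=> expect f ^+ 2)) => [|nu]; last by rewrite full.
  rewrite expect_cst.
  transitivity (expect (fun nu => f nu ^+ 2) - 2 * expect f * expect f + expect f ^+ 2); last by ring.
  rewrite -[in RHS]expectZ -expectB -[X in _ + X]expect_cst -expectD.
  by apply: eq_expect => nu; ring.
apply: le_trans (step _) _; rewrite big_enum /=; apply: ler_sum => j _.
(* [avg j] fixes [h j], so subtracting it leaves the residual [f - avg j f] unchanged, and a
   residual is no larger than the function itself in second moment. *)
pose g nu := f nu - h j nu.
have -> : expect (fun nu => (f nu - avg j f nu) ^+ 2) = expect (fun nu => (g nu - avg j g nu) ^+ 2).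
  apply: eq_expect => nu; rewrite avgB (avg_indep (hi j)) /g; congr (_ ^+ 2); ring.
rewrite expect_sqr_avg gerBl; apply: expect_ge0 => nu; apply: sqr_ge0.
Qed.

End ProductExpectation.

(** * Cayley's formula *)

Section ForestWeight.
Variables (R : realFieldType) (n1 : nat).
Local Notation I1 := 'I_n1.
Implicit Types (l : seq (I1 * I1)) (C : {set I1}).

Definition fiber l C (r : I1) := [set z in C | uf l z == r].

(** The number of ways to choose one root in each class on [C]. *)
Definition forest_weight l C : R := \prod_(r in uf l @: C) #|fiber l C r|%:R.

Definition rooted_forests l C : R := (acyclic l)%:R * forest_weight l C.

Lemma fiber_gt0 l C x : x \in C -> (0 < #|fiber l C (uf l x)|)%N.
Proof. by move=> xC; apply/card_gt0P; exists x; rewrite inE xC eqxx. Qed.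

(** Joining classes of sizes a and b replaces the factor ab by a + b = ab (1/a + 1/b). *)
Lemma forest_weight_cons l C x y : x \in C -> y \in C -> uf l x != uf l y ->
  forest_weight ((x, y) :: l) C = forest_weight l C *
    (#|fiber l C (uf l x)|%:R^-1 + #|fiber l C (uf l y)|%:R^-1).
Proof.
move=> xC yC ne.
have ufE z : uf ((x, y) :: l) z = if uf l z == uf l x then uf l y else uf l z by [].
have imE : uf ((x, y) :: l) @: C = (uf l @: C) :\ uf l x.
  apply/setP=> t; apply/imsetP/setD1P => [[z zC ->]|[nt /imsetP[z zC Ez]]].
    rewrite ufE; case: (boolP (uf l z == uf l x)) => [_|nz]; first by rewrite eq_sym imset_f.
    by rewrite imset_f.
  by exists z => //; rewrite ufE -Ez (negPf nt).
rewrite /forest_weight imE (bigD1 (uf l y)) /=; last by rewrite in_setD1 eq_sym ne imset_f.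
rewrite [in RHS](bigD1 (uf l x)) ?imset_f //= [in RHS](bigD1 (uf l y)) /=; last by rewrite imset_f // eq_sym.
have -> : #|fiber ((x, y) :: l) C (uf l y)| = (#|fiber l C (uf l x)| + #|fiber l C (uf l y)|)%N.
  rewrite -(cardsID [set z | uf l z == uf l x]); congr (_ + _)%N; apply: eq_card => z.
    rewrite !inE ufE.
    by case: (uf l z == uf l x); rewrite ?eqxx ?andbT ?andbF.
  rewrite !inE ufE.
  by case: (altP (uf l z =P uf l x)) => [->|]; rewrite //= (negPf ne) andbF.
have -> : \prod_(i in uf l @: C :\ uf l x | i != uf l y) (#|fiber ((x, y) :: l) C i|%:R : R) =
    \prod_(i | (i \in uf l @: C) && (i != uf l x) && (i != uf l y)) #|fiber l C i|%:R.
  apply: eq_big => [i|i]; first by rewrite in_setD1 [(i != _) && (i \in _)]andbC.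
  rewrite in_setD1 => /andP[/andP[ix _] iy]; congr (_%:R); apply: eq_card => z.
  rewrite !inE ufE.
  case: (altP (uf l z =P uf l x)) => [->|//]; congr (_ && _).
  by rewrite eq_sym (negPf iy) eq_sym (negPf ix).
rewrite natrD; have := fiber_gt0 l xC; have := fiber_gt0 l yC.
rewrite -!(ltr_nat R) => /lt0r_neq0 hy /lt0r_neq0 hx.
by field; rewrite hx hy.
Qed.

Lemma sum_inv_fiber l C : \sum_(x in C) (#|fiber l C (uf l x)|%:R^-1 : R) = #|uf l @: C|%:R.
Proof.
rewrite (partition_big_imset (uf l)) -sum1_card natr_sum; apply: eq_bigr => r /imsetP[x xC ->].
rewrite (eq_bigr (fun=> #|fiber l C (uf l x)|%:R^-1)) => [|z /andP[_ /eqP -> //]].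
rewrite (eq_bigl (mem (fiber l C (uf l x)))) => [|z]; last by rewrite inE inE.
rewrite sumr_const -[LHS]mulr_natr mulVf // pnatr_eq0 -lt0n; exact: fiber_gt0.
Qed.

Lemma sum_pairs (C : {set I1}) (F : {set I1} -> R) :
  2 * \sum_(N : {set I1} | (N \subset C) && (#|N| == 2)) F N =
  \sum_(x in C) \sum_(y in C | y != x) F [set x; y].
Proof.
rewrite pair_big_dep /=.
rewrite (partition_big (fun q : I1 * I1 => [set q.1; q.2])
   (fun N : {set I1} => (N \subset C) && (#|N| == 2))) /=; last first.
  by case=> x y /= /and3P[xC yC yx]; rewrite subUset !sub1set xC yC cards2 [x == y]eq_sym yx.
rewrite big_distrr; apply: eq_bigr => N /andP[NC /cards2P[a [b [ab EN]]]] /=.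
have aC : a \in C by apply: (subsetP NC); rewrite EN set21.
have bC : b \in C by apply: (subsetP NC); rewrite EN set22.
rewrite (eq_bigr (fun=> F N)) => [|q /andP[_ /eqP -> //]].
rewrite (eq_bigl (mem [set (a, b); (b, a)])) => [|[x y] /=].
  by rewrite sumr_const cards2 xpair_eqE (negPf ab) /= mulr_natl.
rewrite !inE !xpair_eqE /= EN; apply/andP/orP => [[/and3P[xC yC yx] /eqP/setP E]|].
  have := E x; have := E y; rewrite !inE !eqxx orbT /=.
  move=> /esym/orP[]/eqP Ey /esym/orP[]/eqP Ex; move: yx; rewrite Ex Ey ?eqxx // => _.
    by right.
  by left.
case=> /andP[/eqP-> /eqP->]; rewrite aC bC /=.
  by rewrite eq_sym ab eqxx.
by rewrite ab setUC eqxx.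
Qed.

Lemma rooted_forests_cons l C x y : x \in C -> y \in C ->
  rooted_forests ((x, y) :: l) C = rooted_forests l C * (uf l x != uf l y)%:R *
    (#|fiber l C (uf l x)|%:R^-1 + #|fiber l C (uf l y)|%:R^-1).
Proof.
move=> xC yC; rewrite /rooted_forests /acyclic.
have := ncl_cons (x, y) l; case: (altP (uf l x =P uf l y)) => /= [_|ne].
  rewrite addn0 => ->; rewrite mulr0 mul0r.
  have := ncl_size l; rewrite card_ord => H.
  by rewrite (_ : _ == _ = false) ?mul0r //; apply/negbTE; rewrite neq_ltn; apply/orP; right; rewrite addnS ltnS.
by move=> <-; rewrite addnAC -addnA addn1 forest_weight_cons // mulr1 mulrA.
Qed.

(* Weighing a forest by its number of rootings makes the sum over its one-edge extensions telescope. *)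
Lemma rooted_forests_step l C : (forall e, e \in l -> e.1 \in C /\ e.2 \in C) ->
  \sum_(N : {set I1} | (N \subset C) && (#|N| == 2))
     rooted_forests (star (enum N) ++ l) C =
  rooted_forests l C * (#|C|%:R * (#|C|%:R - (size l)%:R - 1)).
Proof.
move=> lC; have two : (2 : R) != 0 by rewrite pnatr_eq0.
apply: (mulfI two); rewrite (sum_pairs C (fun N => rooted_forests (star (enum N) ++ l) C)).
have E x y : x \in C -> y \in C -> y != x -> rooted_forests (star (enum [set x; y]) ++ l) C =
   rooted_forests l C * (uf l x != uf l y)%:R *
    (#|fiber l C (uf l x)|%:R^-1 + #|fiber l C (uf l y)|%:R^-1).
  move=> xC yC yx; have := cards2 x y; rewrite [x == y]eq_sym yx cardE.
  have : forall z, z \in enum [set x; y] = (z == x) || (z == y).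
    by move=> z; rewrite mem_enum !inE.
  have := enum_uniq [set x; y]; case: (enum _) => [|a [|b [|]]] //=.
  rewrite inE andbT => ab H _.
  have := H a; have := H b; rewrite !inE !eqxx orbT /=.
  move=> /esym/orP[]/eqP eb /esym/orP[]/eqP ea; move: ab; rewrite ?ea ?eb ?eqxx // => _.
    rewrite rooted_forests_cons // [_ == uf l x]eq_sym; congr (_ * _); by rewrite addrC.
  by rewrite rooted_forests_cons.
transitivity (\sum_(x in C) \sum_(y in C) rooted_forests l C * (uf l x != uf l y)%:R *
    (#|fiber l C (uf l x)|%:R^-1 + #|fiber l C (uf l y)|%:R^-1)).
  apply: eq_bigr => x xC; rewrite (bigD1 x xC) /= eqxx mulr0 mul0r add0r.
  by apply: eq_bigr => y /andP[yC yx]; rewrite E.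
(* A vertex in a class of size a contributes (|C| - a) / a. Summing 1/a over vertices counts the
   classes, of which a forest has |C| - [size l], whence [A] = |C| (|C| - [size l] - 1). *)
pose A := \sum_(x in C) \sum_(y in C) ((uf l x != uf l y)%:R * #|fiber l C (uf l x)|%:R^-1 : R).
have -> : \sum_(x in C) \sum_(y in C) rooted_forests l C * (uf l x != uf l y)%:R *
    (#|fiber l C (uf l x)|%:R^-1 + #|fiber l C (uf l y)|%:R^-1) = rooted_forests l C * (A + A).
  have A' : A = \sum_(x in C) \sum_(y in C) ((uf l y != uf l x)%:R * #|fiber l C (uf l y)|%:R^-1 : R).
    by rewrite /A exchange_big.
  rewrite {2}A' /A -big_split big_distrr /=; apply: eq_bigr => x _.
  rewrite -big_split big_distrr /=; apply: eq_bigr => y _.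
  rewrite -mulrA; congr (_ * _); rewrite mulrDr; congr (_ + _).
  by rewrite eq_sym.
rewrite /rooted_forests; case: (boolP (acyclic l)) => [/eqP ac|_]; last by rewrite !mul0r mulr0.
have -> : A = #|C|%:R * (#|C|%:R - (size l)%:R - 1).
  have -> : A = \sum_(x in C) (#|C|%:R * #|fiber l C (uf l x)|%:R^-1 - 1).
    apply: eq_bigr => x xC; rewrite -big_distrl /= -natr_sum.
    have -> : (\sum_(y in C) (uf l x != uf l y))%N = (#|C| - #|fiber l C (uf l x)|)%N.
      have -> : fiber l C (uf l x) = C :&: [set z | uf l z == uf l x].
        by apply/setP=> z; rewrite !inE.
      rewrite -(cardsID [set z | uf l z == uf l x] C).
      rewrite addKn -sum1_card big_mkcond [RHS]big_mkcond; apply: eq_bigr => y _.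
      by rewrite !inE eq_sym; case: (_ == _); case: (y \in C).
    have f0 := fiber_gt0 l xC; rewrite natrB ?subset_leq_card //; last first.
      by apply/subsetP=> z; rewrite inE => /andP[].
    by rewrite mulrBl mulfV // pnatr_eq0 -lt0n.
  rewrite sumrB -big_distrr /= sum_inv_fiber sumr_const -[1 *+ _]/(#|C|%:R).
  have -> : (#|uf l @: C|%:R : R) = #|C|%:R - (size l)%:R.
    have := ncl_split lC => H; apply/eqP; rewrite eq_sym subr_eq -natrD eqr_nat; apply/eqP.
    by move: H ac; card_lia.
  by ring.
by ring.
Qed.

End ForestWeight.

(** * Expectations in the random bipartite graph *)

Section Model.
Variables (R : realFieldType) (n m : nat) (p : R).
Hypothesis p01 : 0 <= p <= 1.
Local Notation I1 := 'I_n.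
Local Notation I2 := 'I_m.
Implicit Types (N W C : {set I1}) (nu : {ffun I2 -> {set I1}}).

Definition nbr_weight N : R := p ^+ #|N| * (1 - p) ^+ (n - #|N|).

Let E := @expect R 'I_m {set 'I_n} nbr_weight.

Lemma nbr_weight_ge0 N : 0 <= nbr_weight N.
Proof. by have /andP[p0 p1] := p01; rewrite mulr_ge0 ?exprn_ge0 ?subr_ge0. Qed.

Lemma nbr_weight_prod N : nbr_weight N = \prod_i (if i \in N then p else 1 - p).
Proof.
rewrite (bigID (mem N)) /=.
rewrite (eq_bigr (fun=> p)) => [|i ->//]; rewrite prodr_const; congr (_ * _).
rewrite (eq_bigr (fun=> 1 - p)) => [|i /negPf ->//]; rewrite prodr_const; congr (_ ^+ _).
have -> : (n - #|N|)%N = #|~: N| by rewrite [#|~: N|]cardsCs setCK card_ord.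
by apply: eq_card => i; rewrite inE.
Qed.

Lemma sum_nbr_weight_superset (A : {set I1}) : \sum_N nbr_weight N * (A \subset N)%:R = p ^+ #|A|.
Proof.
have -> : p ^+ #|A| = \prod_i (p + (if i \in A then 0 else 1 - p)).
  rewrite (bigID (mem A)) /= [X in _ * X]big1 ?mulr1 => [|i /negPf ->]; last by rewrite addrC subrK.
  by rewrite (eq_bigr (fun=> p)) ?prodr_const // => i ->; rewrite addr0.
rewrite bigA_distr; apply: eq_bigr => N _; rewrite nbr_weight_prod.
case: (boolP (A \subset N)) => [AN|/subsetPn[i iA iN]].
  rewrite mulr1; apply: eq_bigr => i _; case: ifP => // /negbT iN.
  by rewrite ifN //; apply: contra iN; apply: (subsetP AN).
by rewrite mulr0 [RHS](bigD1 i) //= (negPf iN) iA mul0r.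
Qed.

Lemma sum_nbr_weight : \sum_N nbr_weight N = 1.
Proof.
rewrite -(expr0 p) -(cards0 I1) -sum_nbr_weight_superset; apply: eq_bigr => N _.
by rewrite sub0set mulr1.
Qed.

Lemma sum_nbr_weight_bin W k : \sum_N nbr_weight N * 'C(#|N :&: W|, k)%:R = 'C(#|W|, k)%:R * p ^+ k.
Proof.
transitivity (\sum_(A : {set I1} | (A \subset W) && (#|A| == k)) \sum_N nbr_weight N * (A \subset N)%:R).
  rewrite exchange_big; apply: eq_bigr => N _; rewrite -big_distrr -natr_sum; congr (_ * _%:R).
  rewrite -cards_draws -sum1_card big_mkcond [RHS]big_mkcond; apply: eq_bigr => A _ /=.
  rewrite !inE subsetI; case: (A \subset N); case: (A \subset W); case: (_ == k) => //.
rewrite (eq_bigr (fun=> p ^+ k)) => [|A /andP[_ /eqP <-]]; last exact: sum_nbr_weight_superset.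
rewrite sumr_const mulr_natl -cards_draws; congr (_ *+ _).
by apply: eq_card => A; rewrite [RHS]inE.
Qed.

(** The probability that the neighbourhood of a right vertex is a given pair. *)
Definition pair_weight : R := p ^+ 2 * (1 - p) ^+ (n - 2).

Lemma sum_nbr_weight_pairs (Q : pred {set I1}) :
  \sum_N nbr_weight N * ((#|N| == 2) && Q N)%:R = #|[set N : {set I1} | (#|N| == 2) && Q N]|%:R * pair_weight.
Proof.
rewrite mulr_natl -sumr_const [RHS]big_mkcond; apply: eq_bigr => N _; rewrite inE.
case: ifP => [/andP[/eqP N2 _]|_]; last by rewrite mulr0.
by rewrite mulr1 /nbr_weight N2.
Qed.

Lemma expect_num_deg2 : E (fun nu => (num_deg2 nu)%:R) = m%:R * ('C(n, 2)%:R * pair_weight).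
Proof.
rewrite /E (eq_expect _ (g := fun nu => \sum_j ((#|nu j| == 2) && true)%:R)); last first.
  move=> nu; rewrite /num_deg2 -sum1_card natr_sum big_mkcond; apply: eq_bigr => j _.
  by rewrite inE andbT; case: ifP.
rewrite expect_sum (eq_bigr (fun=> 'C(n, 2)%:R * pair_weight)) => [|j _].
  by rewrite sumr_const card_ord [RHS]mulr_natl.
rewrite (expect_marginal sum_nbr_weight j (fun N => ((#|N| == 2) && true)%:R)) sum_nbr_weight_pairs.
congr (_%:R * _); rewrite -[n in RHS]card_ord -card_draws; apply: eq_card => N.
by rewrite !inE andbT.
Qed.

Lemma sum_nbr_weight_bin_card k : \sum_N nbr_weight N * 'C(#|N|, k)%:R = 'C(n, k)%:R * p ^+ k.
Proof.
rewrite -[n in RHS]card_ord -cardsT -sum_nbr_weight_bin; apply: eq_bigr => N _.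
by rewrite setIT.
Qed.

Lemma expect_deg3_mass : E (fun nu => (deg3_mass nu)%:R) <= m%:R * (3 * 'C(n, 3)%:R * p ^+ 3).
Proof.
have bin3 d : (2 < d -> d <= 3 * 'C(d, 3))%N.
  case: d => [|[|[|d]]] // _; elim: d => [//|d IH].
  rewrite binS; have : (0 < 'C(d.+3, 2))%N by rewrite bin_gt0.
  by move: IH; set x := 'C(_, 3); set y := 'C(_, 2); lia.
apply: le_trans (_ : E (fun nu => \sum_j 3 * 'C(#|nu j|, 3)%:R) <= _).
  apply: (expect_le nbr_weight_ge0) => nu; rewrite /deg3_mass natr_sum big_mkcond; apply: ler_sum => j _.
  case: ifP => [/bin3|_]; first by rewrite -natrM ler_nat.
  by rewrite mulr_ge0.
rewrite /E expect_sum (eq_bigr (fun=> 3 * 'C(n, 3)%:R * p ^+ 3)) => [|j _].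
  by rewrite sumr_const card_ord [X in _ <= X]mulr_natl.
rewrite expectZ (expect_marginal sum_nbr_weight j (fun N => 'C(#|N|, 3)%:R)) sum_nbr_weight_bin_card.
by rewrite mulrA.
Qed.

(** Efron-Stein with [h j] the excess after emptying [j]. A degree d gives an increment at most d -
    1, and (d - 1)^2 <= d (d - 1) = 2 C(d, 2). *)
Lemma variance_excess :
  E (fun nu => ((excess (star_seq nu))%:R - E (fun nu => (excess (star_seq nu))%:R)) ^+ 2) <=
  m%:R * (2 * 'C(n, 2)%:R * p ^+ 2).
Proof.
pose h j nu : R := (excess (star_seq (upd nu j set0)))%:R.
apply: le_trans (efron_stein nbr_weight_ge0 sum_nbr_weight _ (h := h) _) _.
  by move=> j nu o; rewrite /h upd_upd.
have -> : m%:R * (2 * 'C(n, 2)%:R * p ^+ 2) = \sum_(j < m) 2 * ('C(n, 2)%:R * p ^+ 2).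
  by rewrite sumr_const card_ord [LHS]mulr_natl mulrA.
apply: ler_sum => j _; rewrite -sum_nbr_weight_bin_card -(expect_marginal sum_nbr_weight j (fun N => 'C(#|N|, 2)%:R)).
rewrite -expectZ; apply: (expect_le nbr_weight_ge0) => nu.
have /andP[] := @excess_remove n m nu (upd nu j set0) j
  (fun j' ne => upd_neq _ _ ne) (updE _ _ _).
rewrite -(ler_nat R) -subr_ge0 => h0; rewrite -(ler_nat R) natrD -lerBlDl => h1.
apply: le_trans (_ : (#|nu j|.-1%:R : R) ^+ 2 <= _).
  by rewrite lerXn2r // nnegrE ler0n.
rewrite -natrX -natrM ler_nat mulnC (bin_ffact _ 2) ffactnS ffactn1 -mulnn.
by rewrite leq_mul ?leq_pred.
Qed.

(** Union bound: at most n^k m^k pairs with sides of size k, each of the k independent right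
    vertices having two neighbours in the left side with probability at most k^2 p^2. Equal sides
    make n m p^2 appear to the power k. *)
Lemma expect_dense_mass L :
  E (fun nu => (dense_mass L nu)%:R) <=
  \sum_(k < L.+1) (k ^ 2)%:R * (n%:R * m%:R * p ^+ 2 * (k ^ 2)%:R) ^+ k.
Proof.
have /andP[p0 p1] := p01.
pose a W : R := 'C(#|W|, 2)%:R * p ^+ 2.
apply: le_trans (_ : \sum_(P : {set I1} * {set I2} | (0 < #|P.1| <= L)%N && (#|P.1| == #|P.2|))
    (#|P.1| * #|P.2|)%:R * a P.1 ^+ #|P.2| <= _).
  rewrite [E _](eq_expect _ (g := fun nu => \sum_(P : {set I1} * {set I2} | (0 < #|P.1| <= L)%N && (#|P.1| == #|P.2|))
     (#|P.1| * #|P.2|)%:R * [forall j in P.2, 1 < #|nu j :&: P.1|]%N%:R)); last first.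
    move=> nu; rewrite /dense_mass natr_sum big_mkcond [RHS]big_mkcond; apply: eq_bigr => P _.
    rewrite /dense_pair andbA; case: (_ && (_ == _)) => //=; case: ifP; by rewrite ?mulr1 ?mulr0.
  rewrite expect_sum; apply: ler_sum => P _; rewrite expectZ ler_wpM2l //.
  apply: le_trans (_ : expect nbr_weight (fun nu => \prod_(j <- enum P.2) (1 < #|nu j :&: P.1|)%N%:R) <= _).
    apply: (expect_le nbr_weight_ge0) => nu.
    case: (boolP [forall j in P.2, _]) => [/forall_inP H|_]; last by apply: prodr_ge0.
    by rewrite big_seq big1 // => j; rewrite mem_enum => /H ->.
  rewrite (expect_prod sum_nbr_weight (fun N => (1 < #|N :&: P.1|)%N%:R)) ?enum_uniq // -cardE.
  apply: lerXn2r; rewrite ?nnegrE.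
  - by apply: sumr_ge0 => N _; rewrite mulr_ge0 ?nbr_weight_ge0.
  - by rewrite mulr_ge0 ?exprn_ge0.
  rewrite /a -sum_nbr_weight_bin; apply: ler_sum => N _; rewrite ler_wpM2l ?nbr_weight_ge0 // ler_nat.
  by case: ltnP => //; rewrite -bin_gt0.
rewrite (partition_big (fun P : {set I1} * {set I2} => inord #|P.1|) (fun _ : 'I_L.+1 => true)) //=.
apply: ler_sum => k _.
apply: le_trans (_ : \sum_(P in setX [set A : {set I1} | #|A| == k] [set B : {set I2} | #|B| == k])
   (k ^ 2)%:R * ((k ^ 2)%:R * p ^+ 2) ^+ k <= _).
  rewrite big_mkcond [X in _ <= X]big_mkcond; apply: ler_sum => -[A B] _ /=.
  case: ifP => [/andP[/andP[/andP[_ PL] /eqP e] /eqP i]|_]; last first.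
    by case: ifP => // _; rewrite mulr_ge0 // exprn_ge0 // mulr_ge0 // exprn_ge0.
  have ek : #|A| = k by rewrite -i inordK.
  rewrite in_setX !inE -e ek eqxx /= -mulnn ler_wpM2l // lerXn2r ?nnegrE ?mulr_ge0 ?exprn_ge0 //.
  rewrite /a ek ler_wpM2r ?exprn_ge0 // ler_nat bin2 mulnn.
  case: (nat_of_ord k) => // d; rewrite -divn2; apply: leq_trans (leq_div _ _) _.
  by rewrite -mulnn leq_mul.
rewrite sumr_const cardsX !card_draws !card_ord -[X in X <= _]mulr_natl mulrCA ler_wpM2l //.
have binX q : ('C(q, k) <= q ^ k)%N.
  apply: leq_trans (_ : q ^_ k <= _)%N; first by rewrite -bin_ffact leq_pmulr ?fact_gt0.
  rewrite ffact_prod -[X in (_ <= _ ^ X)%N]card_ord -prod_nat_const; apply: leq_prod => i _; apply: leq_subr.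
have -> : n%:R * m%:R * p ^+ 2 * (k ^ 2)%:R = (n * m)%:R * ((k ^ 2)%:R * p ^+ 2) :> R.
  by rewrite natrM; ring.
rewrite [X in _ <= X]exprMn -natrX; apply: ler_wpM2r.
  by rewrite exprn_ge0 // mulr_ge0 // exprn_ge0.
by rewrite ler_nat expnMn leq_mul ?binX.
Qed.

(** * Expected number of tree components *)

Section Trees.
Variable C : {set I1}.
(** In a tree component on [C], the right vertices that are edges of the tree are [inner] and all
    others are [good]. *)
Let good N : R := (~~ ((#|N| == 2) && (N :&: C != set0)))%:R.
Let inner N : R := ((#|N| == 2) && (N \subset C))%:R.

(** The right vertices of [s] are integrated out one at a time: averaging over the neighbourhood of
    the last inserted edge is one use of [rooted_forests_step]. *)
Lemma expect_rooted_forests (G : {ffun I2 -> {set I1}} -> R) s : uniq s ->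
  (forall j, j \in s -> indep j G) ->
  E (fun nu => G nu * (\prod_(j <- s) inner (nu j) * rooted_forests R (star_on s nu) C)) =
  E G * \prod_(i < size s) (pair_weight * (#|C|%:R * (#|C|%:R - i%:R - 1))).
Proof.
elim: s => [_ _|j s IH] /=.
  rewrite big_ord0 mulr1; apply: eq_expect => nu; rewrite big_nil mul1r /rooted_forests.
  rewrite /acyclic ncl_nil card_ord addn0 eqxx mul1r /forest_weight.
  rewrite big1 ?mulr1 // => r; rewrite imset_id => rC.
  rewrite (_ : fiber _ _ _ = [set r]) ?cards1 //.
  by apply/setP=> z; rewrite !inE -[uf _ z]/z; case: eqP => [->|]; rewrite ?andbF ?rC.
case/andP => js us Gi; rewrite big_ord_recr /= mulrA -IH //; last first.
  by move=> i si; apply: Gi; rewrite inE si orbT.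
rewrite mulrC -expectZ /E -(expect_avg sum_nbr_weight j); apply: eq_expect => nu.
have upds o i : i \in s -> upd nu j o i = nu i.
  by move=> si; rewrite upd_neq //; apply: contraNneq js => <-.
have st o : star_on (j :: s) (upd nu j o) = star (enum o) ++ star_on s nu.
  rewrite /star_on /= updE; congr (_ ++ flatten _); apply/eq_in_map => i si.
  by rewrite upds.
rewrite /avg (eq_bigr (fun o => G nu * \prod_(i <- s) inner (nu i) *
    (nbr_weight o * (inner o * rooted_forests R (star (enum o) ++ star_on s nu) C)))); last first.
  move=> o _; rewrite (Gi j (mem_head _ _)) st big_cons updE.
  rewrite (eq_big_seq (fun i => inner (nu i))) => [|i si]; last by rewrite upds.
  by ring.
rewrite -big_distrr /=.
(* Both sides vanish unless the earlier edges are pairs inside [C], which is what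
   [rooted_forests_step] requires. *)
case: (boolP (all (fun i => inner (nu i) != 0) s)) => [/allP al|/allPn[i si]]; last first.
  rewrite negbK => /eqP i0; rewrite (_ : \prod_(i <- s) _ = 0) ?(mulr0, mul0r) //.
  by apply/eqP; rewrite prodf_seq_eq0; apply/hasP; exists i => //=; rewrite i0.
have inn i : i \in s -> #|nu i| = 2 /\ nu i \subset C.
  move/al; rewrite /inner pnatr_eq0 eqb0 negbK => /andP[/eqP n2 iC].
  by [].
have -> : \sum_o nbr_weight o * (inner o * rooted_forests R (star (enum o) ++ star_on s nu) C) =
   pair_weight * \sum_(o : {set I1} | (o \subset C) && (#|o| == 2)) rooted_forests R (star (enum o) ++ star_on s nu) C.
  rewrite big_distrr [RHS]big_mkcond; apply: eq_bigr => o _ /=; rewrite /inner andbC.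
  case: ifP => [/andP[_ /eqP o2]|_]; last by rewrite mul0r mulr0.
  by rewrite mul1r /nbr_weight o2.
rewrite rooted_forests_step => [|e /mem_star_on[i si /star_mem[e1 e2]]]; last first.
  by have [_ /subsetP iC] := inn _ si; split; apply: iC.
have -> : size (star_on s nu) = size s.
  rewrite size_star_on (eq_big_seq (fun=> 1%N)) => [|i /inn[-> //]].
  by rewrite sum1_size.
by ring.
Qed.

Lemma forest_weight_tree l : acyclic l -> (forall e, e \in l -> e.1 \in C /\ e.2 \in C) ->
  size l = #|C|.-1 -> (0 < #|C|)%N -> forest_weight R l C = #|C|%:R.
Proof.
move=> /eqP ac lC sl C0.
have /cards1P[t Et] : #|uf l @: C| == 1%N.
  by have := ncl_split lC; move: ac sl C0; card_lia.
rewrite /forest_weight Et big_set1; congr _%:R; apply: eq_card => z; rewrite inE.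
case: (boolP (z \in C)) => //= zC; apply/eqP/set1P; by rewrite -Et imset_f.
Qed.

(** [J] guesses the set of right vertices touching [C], and only the correct guess survives. The
    factor |C| on the left counts the rootings of a single tree. *)
Lemma tree_class_sum nu : (0 < #|C|)%N ->
  #|C|%:R * (tree_class nu C)%:R = \sum_(J : {set I2} | #|J| == #|C|.-1)
    ((\prod_(j <- enum (~: J)) good (nu j)) *
     (\prod_(j <- enum J) inner (nu j) * rooted_forests R (star_on (enum J) nu) C)).
Proof.
move=> C0; set T := touching nu C.
have zero J : J != T -> (\prod_(j <- enum (~: J)) good (nu j)) * \prod_(j <- enum J) inner (nu j) = 0.
  move=> JT; have /existsP[j] : [exists j, (j \in J) != (j \in T)].
    by apply: contraNT JT => /existsPn H; apply/eqP/setP => j; apply/eqP; have := H j; rewrite negbK.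
  case: (boolP (j \in J)) => jJ jT; apply/eqP; rewrite mulf_eq0 !prodf_seq_eq0; apply/orP; [right|left].
    have {}jT : j \notin T by move: jT; case: (j \in T).
    apply/hasP; exists j; rewrite ?mem_enum //= /inner pnatr_eq0 eqb0.
    apply: contra jT => /andP[nj jC].
    by rewrite inE nj (setIidPl jC) -card_gt0 (eqP nj).
  have {}jT : j \in T by move: jT; case: (j \in T).
  apply/hasP; exists j; rewrite ?mem_enum ?inE //= /good.
  by move: jT; rewrite inE => ->.
have [TC|TC] := eqVneq #|T| #|C|.-1; last first.
  rewrite tree_classP // -/T (negPf TC) mulr0 big1 // => J /eqP cJ.
  by rewrite mulrA zero ?mul0r //; apply: contraNneq TC => <-; apply/eqP.
rewrite (bigD1 T) ?TC //= [X in _ + X]big1 ?addr0 => [|J /andP[_ /zero]]; last first.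
  by rewrite mulrA => ->; rewrite mul0r.
have -> : \prod_(j <- enum (~: T)) good (nu j) = 1.
  rewrite big_seq big1 // => j; rewrite mem_enum inE /T inE /good => ->.
  by [].
rewrite mul1r tree_classP // -/T TC eqxx /=.
have T2 j : j \in T -> #|nu j| = 2 by rewrite inE => /andP[/eqP].
case: (boolP [forall j in T, _]) => [/forall_inP H|/forall_inPn[j jT jC]]; last first.
  rewrite mulr0; apply/esym/eqP; rewrite mulf_eq0 prodf_seq_eq0; apply/orP; left.
  by apply/hasP; exists j; rewrite ?mem_enum //= /inner (negPf jC) andbF.
rewrite /= big_seq big1 ?mul1r; last first.
  by move=> j; rewrite mem_enum => jT; rewrite /inner T2 // eqxx H.
rewrite /rooted_forests; case: (boolP (acyclic _)) => ac; rewrite ?mulr0 ?mul0r //.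
rewrite mulr1 mul1r forest_weight_tree // => [e /mem_star_on[j]|].
  by rewrite mem_enum => /H/subsetP jC /star_mem[/jC -> /jC ->].
by rewrite size_pairs_on.
Qed.

Lemma sum_nbr_weight_good : \sum_N nbr_weight N * good N =
  1 - ('C(n, 2) - 'C(n - #|C|, 2))%:R * pair_weight.
Proof.
rewrite (eq_bigr (fun N => nbr_weight N - nbr_weight N * ((#|N| == 2) && (N :&: C != set0))%:R)); last first.
  by move=> N _; rewrite /good; case: (_ && _); rewrite /= ?(mulr0, mulr1, subrr, subr0).
rewrite sumrB sum_nbr_weight (sum_nbr_weight_pairs (fun N => N :&: C != set0)); congr (_ - _%:R * _).
have -> : 'C(n, 2) = #|[set N : {set I1} | #|N| == 2]| by rewrite card_draws card_ord.
have -> : 'C(n - #|C|, 2) = #|[set N : {set I1} | N \subset ~: C & #|N| == 2]|.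
  by rewrite cards_draws [#|~: C|]cardsCs setCK card_ord.
rewrite -(cardsID [set N : {set I1} | N :&: C == set0] [set N : {set I1} | #|N| == 2]).
have -> : [set N : {set I1} | #|N| == 2] :&: [set N : {set I1} | N :&: C == set0] =
    [set N : {set I1} | N \subset ~: C & #|N| == 2].
  by apply/setP=> N; rewrite !inE andbC -disjoints_subset setI_eq0.
by rewrite addKn; apply: eq_card => N; rewrite !inE andbC.
Qed.

(** Cayley's formula in disguise: with k = |C| - 1, the k steps contribute |C|^k k!, that is |C|
    rootings of |C|^(|C| - 2) trees, times k! ways to assign tree edges to the chosen right
    vertices. *)
Lemma expect_tree_class : (0 < #|C|)%N ->
  #|C|%:R * E (fun nu => (tree_class nu C)%:R) =
  ('C(m, #|C|.-1) * (#|C|.-1)`!)%:R *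
  (1 - ('C(n, 2) - 'C(n - #|C|, 2))%:R * pair_weight) ^+ (m - #|C|.-1) *
  (pair_weight * #|C|%:R) ^+ #|C|.-1.
Proof.
move=> C0; rewrite -expectZ /E (eq_expect _ (fun nu => tree_class_sum nu C0)) expect_sum.
set k := #|C|.-1.
have -> : ('C(m, k) * k`!)%:R * (1 - ('C(n, 2) - 'C(n - #|C|, 2))%:R * pair_weight) ^+ (m - k) *
  (pair_weight * #|C|%:R) ^+ k =
  \sum_(J : {set I2} | #|J| == k) ((\sum_N nbr_weight N * good N) ^+ (m - k) *
    \prod_(i < k) (pair_weight * (#|C|%:R * (#|C|%:R - i%:R - 1)))).
  rewrite sum_nbr_weight_good (eq_bigl (fun J : {set I2} => J \in [set J : {set I2} | #|J| == k])) => [|J]; last by rewrite inE.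
  rewrite sumr_const card_draws card_ord -[RHS]mulr_natl natrM.
  have -> : \prod_(i < k) (pair_weight * (#|C|%:R * (#|C|%:R - i%:R - 1))) =
     (pair_weight * #|C|%:R) ^+ k * k`!%:R.
    rewrite -ffactnn ffact_prod natr_prod -[X in _ ^+ X](card_ord k) -prodr_const -big_split /=.
    apply: eq_bigr => i _; rewrite mulrA natrB; last exact: ltnW.
    have -> : (#|C|%:R : R) = k%:R + 1 by rewrite natr1 /k prednK.
    by congr (_ * _); rewrite [LHS]addrAC addrK.
  by ring.
apply: eq_bigr => J /eqP cJ.
apply: etrans (@expect_rooted_forests (fun nu => \prod_(j <- enum (~: J)) good (nu j))
  (enum J) (enum_uniq _) _) _.
  move=> j; rewrite mem_enum => jJ nu o; apply: eq_big_seq => i; rewrite mem_enum inE => iJ.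
  by rewrite upd_neq //; apply: contraNneq iJ => ->.
rewrite -cardE cJ /E (expect_prod sum_nbr_weight good) ?enum_uniq // -cardE; congr (_ ^+ _ * _).
by rewrite [#|~: J|]cardsCs setCK card_ord cJ.
Qed.

End Trees.

Lemma expect_num_trees k : E (fun nu => (num_trees k.+1 nu)%:R) =
  'C(n, k.+1)%:R * (('C(m, k) * k`!)%:R *
  (1 - ('C(n, 2) - 'C(n - k.+1, 2))%:R * pair_weight) ^+ (m - k) *
  (pair_weight * k.+1%:R) ^+ k / k.+1%:R).
Proof.
rewrite /E (eq_expect _ (g := fun nu => \sum_(C : {set I1} | #|C| == k.+1) (tree_class nu C)%:R)); last first.
  move=> nu; rewrite /num_trees -sum1_card natr_sum big_mkcond [RHS]big_mkcond.
  by apply: eq_bigr => C _; rewrite inE; case: (tree_class nu C); case: (_ == _).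
rewrite expect_sum.
rewrite (eq_bigr (fun=> ('C(m, k) * k`!)%:R *
  (1 - ('C(n, 2) - 'C(n - k.+1, 2))%:R * pair_weight) ^+ (m - k) *
  (pair_weight * k.+1%:R) ^+ k / k.+1%:R)) => [|C /eqP cC].
  rewrite (eq_bigl (fun C : {set I1} => C \in [set C : {set I1} | #|C| == k.+1])) => [|J]; last by rewrite inE.
  by rewrite sumr_const card_draws card_ord [RHS]mulr_natl.
have := @expect_tree_class C; rewrite cC => /(_ isT) /= <-.
by rewrite mulrAC mulfV ?mul1r // pnatr_eq0.
Qed.

Definition graph_of nu : {set I1 * I2} := [set x | x.1 \in nu x.2].

Lemma nbr_graph_of nu : nbr (graph_of nu) = nu :> (I2 -> {set I1}).
Proof. by apply: funext => j; apply/setP=> i; rewrite !inE. Qed.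

Lemma sum_graphs (F : {set I1 * I2} -> R) :
  \sum_(S : {set I1 * I2}) p ^+ #|S| * (1 - p) ^+ (n * m - #|S|) * F S = E (fun nu => F (graph_of nu)).
Proof.
rewrite (reindex graph_of) /=; last first.
  exists (fun S => [ffun j => nbr S j]) => [nu _|S _].
    by apply/ffunP=> j; rewrite ffunE nbr_graph_of.
  by apply/setP=> -[i j]; rewrite !inE ffunE inE.
apply: eq_bigr => nu _; congr (_ * _).
have cE : #|graph_of nu| = (\sum_j #|nu j|)%N.
  have := card_edges (graph_of nu) predT; rewrite nbr_graph_of => <-.
  by apply: eq_card => x; rewrite !inE andbT.
have le j : (#|nu j| <= n)%N by rewrite -[X in (_ <= X)%N]card_ord max_card.
rewrite cE /nbr_weight big_split /= -!expr_sum; congr (_ * _ ^+ _).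
rewrite -[X in (_ * X)%N]card_ord mulnC -sum_nat_const -sumnB //.
Qed.

End Model.

(** * Asymptotics *)

Local Open Scope classical_set_scope.

Section Limits.
Variable R : realType.

Lemma cvg_invn (u : nat -> nat) : u @ \oo --> \oo -> (fun n => ((u n)%:R^-1 : R)) @ \oo --> 0.
Proof.
move=> /cvgnyPge Hu; apply/cvgrPdist_le => e e0.
have := Hu (Num.truncn e^-1).+1; apply: filterS => n un.
have e1 : e^-1 < (u n)%:R.
  by apply: lt_le_trans (truncnS_gt _) _; rewrite ler_nat.
have u0 : 0 < (u n)%:R :> R by apply: lt_trans e1; rewrite invr_gt0.
by rewrite sub0r normrN ger0_norm ?invr_ge0 ?ler0n // -[e]invrK lef_pV2 ?posrE ?invr_gt0 // ltW.
Qed.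

Lemma cvg_expn (u : nat -> R) (l : R) k :
  u @ \oo --> l -> (fun n => u n ^+ k) @ \oo --> l ^+ k.
Proof.
move=> ul; elim: k => [|k IH].
  by under eq_fun do rewrite expr0; exact: cvg_cst.
by under eq_fun do rewrite exprS; rewrite exprS; exact: cvgM.
Qed.

Lemma cvg_ffact_ratio (u : nat -> nat) k : u @ \oo --> \oo ->
  (fun n => (u n ^_ k)%:R / (u n)%:R ^+ k : R) @ \oo --> (1 : R).
Proof.
move=> Hu; elim: k => [|k IH].
  under eq_fun do rewrite ffactn0 expr0 divr1.
  exact: cvg_cst.
have H : (fun n => ((u n ^_ k)%:R / (u n)%:R ^+ k) * (1 - k%:R * (u n)%:R^-1) : R) @ \oo --> (1 * (1 - k%:R * 0) : R).
  apply: cvgM => //; apply: cvgB; first exact: cvg_cst.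
  apply: cvgM; [exact: cvg_cst|exact: cvg_invn].
rewrite mulr0 subr0 mulr1 in H.
apply: cvg_trans H; apply: near_eq_cvg.
have /cvgnyPge/(_ k.+1) := Hu; apply: filterS => n un.
have u0 : (u n)%:R != 0 :> R by rewrite pnatr_eq0 -lt0n; apply: leq_ltn_trans un.
rewrite ffactnSr natrM natrB; last exact: ltnW.
rewrite exprSr; field; rewrite u0 expf_neq0 //.
Qed.

(** Squeezes (1 - x)^q between exp(- q x / (1 - x)) and exp(- q x). *)
Lemma cvg_expr_1B (x : nat -> R) (q : nat -> nat) (a : R) :
  (\forall n \near \oo, 0 <= x n) -> x @ \oo --> (0 : R) ->
  (fun n => (q n)%:R * x n) @ \oo --> a ->
  (fun n => (1 - x n) ^+ q n) @ \oo --> expR (- a).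
Proof.
move=> x0 xl ql.
have up : (fun n => expR (- ((q n)%:R * x n))) @ \oo --> expR (- a).
  by apply: continuous_cvg; [exact: continuous_expR|exact: cvgN].
have lo : (fun n => expR (- ((q n)%:R * x n * (1 - x n)^-1))) @ \oo --> expR (- a).
  apply: continuous_cvg; first exact: continuous_expR.
  apply: cvgN; rewrite -[X in _ --> X]mulr1 -[X in a * X]invr1; apply: cvgM => //.
  apply: cvgV; first exact: oner_neq0.
  rewrite -[X in _ --> X]subr0; apply: cvgB => //; exact: cvg_cst.
apply: (squeeze_cvgr _ lo up).
have x1 : \forall n \near \oo, x n < 1.
  by apply: cvgr_lt xl _ _; exact: ltr01.
near=> n.
have h0 : 0 <= x n by near: n.
have h1 : 0 < 1 - x n by rewrite subr_gt0; near: n.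
apply/andP; split.
  have -> : - ((q n)%:R * x n / (1 - x n)) = (q n)%:R * - (x n / (1 - x n)) by rewrite mulrN mulrA.
  rewrite expRM_natl lerXn2r ?nnegrE ?expR_ge0 ?(ltW h1) //.
  rewrite expRN -[leRHS]invrK lef_pV2 ?posrE ?expR_gt0 ?invr_gt0 //.
  apply: le_trans (expR_ge1Dx _); rewrite le_eqVlt; apply/orP; left; apply/eqP.
  by field; rewrite gt_eqF.
rewrite -mulrN expRM_natl lerXn2r ?nnegrE ?expR_ge0 ?(ltW h1) //.
exact: expR_ge1Dx.
Unshelve. all: by end_near. Qed.

(* The limit of [n^-1] times the number of tree components with [k + 1] vertices. *)
Definition tau (c : R) k : R :=
  c ^+ k * k.+1%:R ^+ k / k.+1%:R / (k.+1)`!%:R * expR (- (k.+1%:R * c)).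

(** * Limits of expectations when n m p^2 = c and n p tends to 0 *)

Section Sparse.
Variables (c : R) (m : nat -> nat) (p : nat -> R).
Hypothesis c0 : 0 < c.
Hypothesis p01 : \forall n \near \oo, 0 <= p n <= 1.
Hypothesis pc : \forall n \near \oo, n%:R * (m n)%:R * p n ^+ 2 = c.
Hypothesis np0 : (fun n => n%:R * p n) @ \oo --> (0 : R).
Hypothesis moo : m @ \oo --> \oo.

Let b n := pair_weight n (p n).
Let idoo : (fun n : nat => n) @ \oo --> \oo := cvg_id.
Let n_gt0 : \forall n \near \oo, (0 < n)%N.
Proof. by exists 1%N. Qed.

Lemma edge_prob_cvg0 : p @ \oo --> (0 : R).
Proof.
apply: (squeeze_cvgr (f := fun=> 0) _ _ np0); last exact: cvg_cst.
near=> n; have /andP[p0 _] : 0 <= p n <= 1 by near: n.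
rewrite p0 ler_peMl // ler1n; near: n; exact: n_gt0.
Unshelve. all: by end_near. Qed.

(** The expected degree n p of a right vertex tends to 0, so the factor (1 - p)^(n - 2) tends to
    1. *)
Lemma pair_rate_cvg : (fun n => n%:R * (m n)%:R * b n) @ \oo --> c.
Proof.
have H : (fun n => c * (1 - p n) ^+ (n - 2)) @ \oo --> c * expR (- 0).
  apply: cvgM; first exact: cvg_cst.
  apply: cvg_expr_1B; [|exact: edge_prob_cvg0|].
    by apply: filterS p01 => n /andP[].
  apply: (squeeze_cvgr (f := fun=> 0) _ _ np0); last exact: cvg_cst.
  by apply: filterS p01 => n /andP[p0 _]; rewrite mulr_ge0 //= ler_wpM2r // ler_nat leq_subr.
rewrite oppr0 expR0 mulr1 in H; apply: cvg_trans H; apply: near_eq_cvg.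
by apply: filterS pc => n /= <-; rewrite /b /pair_weight mulrA.
Unshelve. all: by end_near. Qed.

Lemma expect_deg2_cvg :
  (fun n => (m n)%:R * ('C(n, 2)%:R * b n) / n%:R) @ \oo --> c / 2.
Proof.
have H : (fun n => n%:R * (m n)%:R * b n * ((n ^_ 2)%:R / n%:R ^+ 2 / 2)) @ \oo --> c * (1 / 2).
  apply: cvgM; first exact: pair_rate_cvg.
  by apply: cvgMl; exact: (cvg_ffact_ratio 2 idoo).
rewrite mul1r in H; apply: cvg_trans H; apply: near_eq_cvg.
near=> n; have n0 : n%:R != 0 :> R by rewrite pnatr_eq0 -lt0n; near: n; exact: n_gt0.
rewrite -bin_ffact natrM (_ : 2`!%:R = 2 :> R) //; field; exact: n0.
Unshelve. all: by end_near. Qed.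

Lemma touching_pairs_cvg k :
  (fun n => ('C(n, 2) - 'C(n - k, 2))%:R / n%:R : R) @ \oo --> (k%:R : R).
Proof.
have H : (fun n => k%:R - (k%:R ^+ 2 + k%:R) / 2 * n%:R^-1 : R) @ \oo --> (k%:R - (k%:R ^+ 2 + k%:R) / 2 * 0 : R).
  apply: cvgB; first exact: cvg_cst.
  apply: cvgM; [exact: cvg_cst|exact: (cvg_invn idoo)].
rewrite mulr0 subr0 in H; apply: cvg_trans H; apply: near_eq_cvg.
near=> n; have n0 : n%:R != 0 :> R by rewrite pnatr_eq0 -lt0n; near: n; exact: n_gt0.
have kn : (k < n)%N by near: n; exact: nbhs_infty_gt.
have bin2R q : (0 < q)%N -> 'C(q, 2)%:R = q%:R * (q%:R - 1) / 2 :> R.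
  move=> q0; have := bin_ffact q 2; rewrite ffactnS ffactn1 => /(congr1 (fun x => x%:R : R)).
  rewrite !natrM -subn1 natrB // => <-; by field.
rewrite natrB; last by apply: leq_bin2l; apply: leq_subr.
rewrite !bin2R ?subn_gt0 //; last by near: n; exact: n_gt0.
rewrite natrB; last exact: ltnW.
by field.
Unshelve. all: by end_near. Qed.

(** The n^(k+1) vertex choices and m^k right vertices meet b^k, which is about (c / (n m))^k, so
    division by n leaves a constant. The power of 1 - D b is the isolation of the tree and tends to
    exp(- (k+1) c). *)
Lemma expect_trees_cvg k :
  (fun n => 'C(n, k.+1)%:R * (('C(m n, k) * k`!)%:R *
  (1 - ('C(n, 2) - 'C(n - k.+1, 2))%:R * b n) ^+ (m n - k) *
  (b n * k.+1%:R) ^+ k / k.+1%:R) / n%:R) @ \oo --> tau c k.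
Proof.
pose D n : R := ('C(n, 2) - 'C(n - k.+1, 2))%:R.
have Dmb : (fun n => D n / n%:R * (n%:R * (m n)%:R * b n)) @ \oo --> k.+1%:R * c.
  by apply: cvgM; [exact: touching_pairs_cvg|exact: pair_rate_cvg].
have minv := cvg_invn moo.
have m0 : \forall n \near \oo, (k < m n)%N.
  by have /cvgnyPge/(_ k.+1) := moo.
have Db0 : (fun n => D n * b n) @ \oo --> (0 : R).
  have H : (fun n => D n / n%:R * (n%:R * (m n)%:R * b n) * (m n)%:R^-1) @ \oo --> k.+1%:R * c * 0.
    by apply: cvgM.
  rewrite mulr0 in H; apply: cvg_trans H; apply: near_eq_cvg.
  near=> n; have n0 : n%:R != 0 :> R by rewrite pnatr_eq0 -lt0n; near: n; exact: n_gt0.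
  have mn0 : (m n)%:R != 0 :> R.
    by rewrite pnatr_eq0 -lt0n; apply: (@leq_ltn_trans k) => //; near: n.
  by field; rewrite n0 mn0.
have powl : (fun n => (1 - D n * b n) ^+ (m n - k)) @ \oo --> expR (- (k.+1%:R * c)).
  apply: cvg_expr_1B => //.
    apply: filterS p01 => n /andP[p0 p1]; by rewrite mulr_ge0 // mulr_ge0 ?exprn_ge0 ?subr_ge0.
  have H : (fun n => D n / n%:R * (n%:R * (m n)%:R * b n) * (1 - k%:R * (m n)%:R^-1)) @ \oo --> k.+1%:R * c * (1 - k%:R * 0).
    apply: cvgM => //; apply: cvgB; first exact: cvg_cst.
    by apply: cvgM => //; exact: cvg_cst.
  rewrite mulr0 subr0 mulr1 in H; apply: cvg_trans H; apply: near_eq_cvg.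
  near=> n; have n0 : n%:R != 0 :> R by rewrite pnatr_eq0 -lt0n; near: n; exact: n_gt0.
  have km : (k < m n)%N by near: n.
  have mn0 : (m n)%:R != 0 :> R by rewrite pnatr_eq0 -lt0n; apply: leq_ltn_trans km.
  rewrite natrB; last exact: ltnW.
  by field; rewrite n0 mn0.
have H : (fun n => ((n ^_ k.+1)%:R / n%:R ^+ k.+1) / (k.+1)`!%:R * ((m n ^_ k)%:R / (m n)%:R ^+ k) *
    (1 - D n * b n) ^+ (m n - k) * (n%:R * (m n)%:R * b n) ^+ k * (k.+1%:R ^+ k / k.+1%:R)) @ \oo -->
    1 / (k.+1)`!%:R * 1 * expR (- (k.+1%:R * c)) * c ^+ k * (k.+1%:R ^+ k / k.+1%:R).
  apply: cvgMl; apply: cvgM; last first.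
    by apply: cvg_expn; exact: pair_rate_cvg.
  apply: cvgM => //; apply: cvgM; last exact: cvg_ffact_ratio.
  by apply: cvgMl; exact: (cvg_ffact_ratio k.+1 idoo).
have -> : tau c k = 1 / (k.+1)`!%:R * 1 * expR (- (k.+1%:R * c)) * c ^+ k * (k.+1%:R ^+ k / k.+1%:R).
  by rewrite /tau; ring.
apply: cvg_trans H; apply: near_eq_cvg.
near=> n; have n0 : n%:R != 0 :> R by rewrite pnatr_eq0 -lt0n; near: n; exact: n_gt0.
have km : (k < m n)%N by near: n.
have mn0 : (m n)%:R != 0 :> R by rewrite pnatr_eq0 -lt0n; apply: leq_ltn_trans km.
have f0 : k`!%:R != 0 :> R by rewrite pnatr_eq0 -lt0n fact_gt0.
rewrite -!bin_ffact -/(D n); set X := (1 - _) ^+ _.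
rewrite !natrM !exprMn exprS; set A : R := 'C(n, _)%:R; set B : R := 'C(_, _)%:R.
set G : R := k`!%:R; rewrite -/G in f0.
set nk := n%:R ^+ k; set mk := (m n)%:R ^+ k; set kk := k.+1%:R ^+ k.
have nk0 : nk != 0 by apply: expf_neq0.
have mk0 : mk != 0 by apply: expf_neq0.
have k0 : k.+1%:R != 0 :> R by rewrite pnatr_eq0.
move: X A B G nk mk kk (k.+1%:R) (n%:R) f0 nk0 mk0 k0 n0 => X A B G nk mk kk K N *.
by field; do ?(apply/andP; split).
Unshelve. all: by end_near. Qed.

Let E n := @expect R 'I_(m n) {set 'I_n} (@nbr_weight R n (p n)).

Lemma expect_num_deg2_cvg : (fun n => @E n (fun nu => (num_deg2 nu)%:R) / n%:R) @ \oo --> c / 2.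
Proof.
apply: cvg_trans expect_deg2_cvg; apply: near_eq_cvg; apply: filterS p01 => n pn.
by rewrite /E expect_num_deg2.
Qed.

Lemma expect_num_trees_cvg k :
  (fun n => @E n (fun nu => (num_trees k.+1 nu)%:R) / n%:R) @ \oo --> tau c k.
Proof.
apply: cvg_trans (@expect_trees_cvg k); apply: near_eq_cvg; apply: filterS p01 => n pn.
by rewrite /E expect_num_trees.
Qed.

Lemma expect_trees_sum_cvg K (F : nat -> R) :
  (fun n => @E n (fun nu => \sum_(k < K.+1) F k * (num_trees k nu)%:R) / n%:R) @ \oo -->
  \sum_(k < K) F k.+1 * tau c k.
Proof.
have H : (fun n => \sum_(k < K) F k.+1 * (@E n (fun nu => (num_trees k.+1 nu)%:R) / n%:R)) @ \oo -->
    \sum_(k < K) F k.+1 * tau c k.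
  elim: K => [|K IH].
    under eq_fun do rewrite big_ord0.
    by rewrite big_ord0; exact: cvg_cst.
  under eq_fun do rewrite big_ord_recr /=.
  rewrite big_ord_recr /=; apply: cvgD => //; apply: cvgM; first exact: cvg_cst.
  exact: expect_num_trees_cvg.
apply: cvg_trans H; apply: near_eq_cvg; near=> n.
have -> : @E n (fun nu => \sum_(k < K.+1) F k * (num_trees k nu)%:R) =
    \sum_(k < K) F k.+1 * @E n (fun nu => (num_trees k.+1 nu)%:R).
  transitivity (@E n (fun nu => \sum_(k < K) F k.+1 * (num_trees k.+1 nu)%:R)).
    apply: eq_expect => nu; rewrite big_ord_recl /= (_ : num_trees 0 nu = 0%N) ?mulr0 ?add0r //.
    apply/eqP; rewrite cards_eq0; apply/eqP/setP=> C; rewrite !inE /tree_class.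
    by case: eqP => [->|]; rewrite ?andbF // ltn0 andbF.
  by rewrite /E expect_sum; apply: eq_bigr => k _; rewrite expectZ.
rewrite big_distrl /=; apply: eq_bigr => k _; by rewrite mulrA.
Unshelve. all: by end_near. Qed.

(** The bound m (n p)^3 / n equals c (n p). *)
Lemma expect_deg3_cvg : (fun n => @E n (fun nu => (deg3_mass nu)%:R) / n%:R) @ \oo --> (0 : R).
Proof.
have H : (fun n => c * (n%:R * p n)) @ \oo --> c * 0.
  by apply: cvgM => //; exact: cvg_cst.
rewrite mulr0 in H; apply: (squeeze_cvgr (f := fun=> 0) _ _ H); last exact: cvg_cst.
near=> n; have pn : 0 <= p n <= 1 by near: n.
have /andP[p0 p1] := pn.
have n0 : 0 < n%:R :> R by rewrite ltr0n; near: n; exact: n_gt0.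
apply/andP; split.
  by rewrite divr_ge0 ?(ltW n0) //; apply: expect_ge0 => // N; apply: nbr_weight_ge0.
rewrite ler_pdivrMr //; apply: le_trans (expect_deg3_mass _ _ pn) _.
have <- : n%:R * (m n)%:R * p n ^+ 2 = c by near: n.
have -> : n%:R * (m n)%:R * p n ^+ 2 * (n%:R * p n) * n%:R = (m n)%:R * (n%:R ^+ 3 * p n ^+ 3) by ring.
rewrite ler_wpM2l // ler_wpM2r ?exprn_ge0 // -natrX -natrM ler_nat.
have := bin_ffact n 3; rewrite [3`!]/=; have : (n ^_ 3 <= n ^ 3)%N.
  rewrite ffact_prod -[X in (_ <= _ ^ X)%N](card_ord 3) -prod_nat_const; apply: leq_prod => i _; apply: leq_subr.
set X := 'C(_, _); set Y := n ^_ 3; set Z := (n ^ 3)%N; rewrite /factorial /=; clearbody X Y Z; lia.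
Unshelve. all: by end_near. Qed.

Lemma expect_dense_cvg L : (fun n => @E n (fun nu => (dense_mass L nu)%:R) / n%:R) @ \oo --> (0 : R).
Proof.
pose B : R := \sum_(k < L.+1) (k ^ 2)%:R * (c * (k ^ 2)%:R) ^+ k.
have H : (fun n : nat => B * n%:R^-1) @ \oo --> B * 0.
  by apply: cvgM; [exact: cvg_cst|exact: (cvg_invn idoo)].
rewrite mulr0 in H; apply: (squeeze_cvgr (f := fun=> 0) _ _ H); last exact: cvg_cst.
near=> n; have pn : 0 <= p n <= 1 by near: n.
have n0 : 0 < n%:R :> R by rewrite ltr0n; near: n; exact: n_gt0.
apply/andP; split.
  by rewrite divr_ge0 ?(ltW n0) //; apply: expect_ge0 => // N; apply: nbr_weight_ge0.
rewrite ler_wpM2r ?invr_ge0 ?(ltW n0) //; apply: le_trans (expect_dense_mass _ _ pn L) _.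
by have -> : n%:R * (m n)%:R * p n ^+ 2 = c by near: n.
Unshelve. all: by end_near. Qed.

Lemma variance_excess_le : \forall n \near \oo,
  @E n (fun nu => ((excess (star_seq nu))%:R - @E n (fun nu => (excess (star_seq nu))%:R)) ^+ 2) <= c * n%:R.
Proof.
near=> n; have pn : 0 <= p n <= 1 by near: n.
have /andP[p0 p1] := pn.
apply: le_trans (variance_excess _ _ pn) _.
have <- : n%:R * (m n)%:R * p n ^+ 2 = c by near: n.
have -> : n%:R * (m n)%:R * p n ^+ 2 * n%:R = (m n)%:R * (n%:R ^+ 2 * p n ^+ 2) by ring.
rewrite ler_wpM2l // ler_wpM2r ?exprn_ge0 // -natrX -natrM ler_nat.
by rewrite mulnC (bin_ffact _ 2) ffactnS ffactn1 -mulnn leq_mul ?leq_pred.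
Unshelve. all: by end_near. Qed.

(** Tree components cover at most n vertices. At c = d^2 this gives convergence of the series in
    [mu]; at c = 1 it bounds the derivative in [excess_growth]. *)
Lemma sum_tau_size_le1 K : \sum_(k < K) k.+1%:R * tau c k <= 1.
Proof.
apply: (ler_cvg_to (@expect_trees_sum_cvg K (fun k => k%:R)) (cvg_cst (1 : R))).
near=> n; have pn : 0 <= p n <= 1 by near: n.
have n0 : 0 < n%:R :> R by rewrite ltr0n; near: n; exact: n_gt0.
rewrite ler_pdivrMr // mul1r -[leRHS](expect_cst 'I_(m n) (sum_nbr_weight n (p n))).
apply: expect_le => [N|nu]; first exact: nbr_weight_ge0.
under eq_bigr do rewrite -natrM.
rewrite -natr_sum ler_nat; exact: sum_trees_size_le.
Unshelve. all: by end_near. Qed.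

Let h n : R := @E n (fun nu : {ffun 'I_(m n) -> {set 'I_n}} => (excess (star_seq nu))%:R) / n%:R.

Lemma expect_excess_ge K e : 0 < e ->
  \forall n \near \oo, c / 2 + \sum_(k < K) tau c k - e <= h n.
Proof.
move=> e0.
have H : (fun n => @E n (fun nu => (num_deg2 nu)%:R) / n%:R +
   @E n (fun nu => \sum_(k < K.+1) 1 * (num_trees k nu)%:R) / n%:R) @ \oo --> c / 2 + \sum_(k < K) 1 * tau c k.
  by apply: cvgD; [exact: expect_num_deg2_cvg|exact: (@expect_trees_sum_cvg K (fun=> 1))].
have {}H := cvgr_ge _ H (c / 2 + \sum_(k < K) tau c k - e).
near=> n; have pn : 0 <= p n <= 1 by near: n.
apply: le_trans (_ : _ <= @E n (fun nu => (num_deg2 nu)%:R) / n%:R +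
   @E n (fun nu => \sum_(k < K.+1) 1 * (num_trees k nu)%:R) / n%:R) _.
  near: n; apply: H; rewrite -subr_gt0.
  by under eq_bigr do rewrite mul1r; lra.
rewrite -mulrDl -expectD ler_wpM2r ?invr_ge0 //.
apply: expect_le => [N|nu]; first exact: nbr_weight_ge0.
under eq_bigr do rewrite mul1r.
rewrite -natr_sum -natrD ler_nat.
have /andP[le _] := excess_pair_seq nu; apply: leq_trans le.
by rewrite leq_add2l sum_trees_le.
Unshelve. all: by end_near. Qed.

(** The term [K.+1%:R^-1] accounts for the components with more than K + 1 vertices. *)
Lemma expect_excess_le K e : 0 < e ->
  \forall n \near \oo, h n <= c / 2 + \sum_(k < K.+1) tau c k + K.+1%:R^-1 + e.
Proof.
move=> e0.
have H : (fun n => @E n (fun nu => (num_deg2 nu)%:R) / n%:R +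
   @E n (fun nu => \sum_(k < K.+2) 1 * (num_trees k nu)%:R) / n%:R + @E n (fun nu => (dense_mass K.+1 nu)%:R) / n%:R
   + @E n (fun nu => (deg3_mass nu)%:R) / n%:R) @ \oo --> c / 2 + \sum_(k < K.+1) 1 * tau c k + 0 + 0.
  apply: cvgD; last exact: expect_deg3_cvg.
  apply: cvgD; last exact: expect_dense_cvg.
  by apply: cvgD; [exact: expect_num_deg2_cvg|exact: (@expect_trees_sum_cvg K.+1 (fun=> 1))].
have {}H := cvgr_le _ H (c / 2 + \sum_(k < K.+1) tau c k + e).
near=> n; have pn : 0 <= p n <= 1 by near: n.
have n0 : 0 < n%:R :> R by rewrite ltr0n; near: n; exact: n_gt0.
have k0 : 0 < K.+1%:R :> R by rewrite ltr0n.
apply: (@le_trans _ _ ((@E n (fun nu => (num_deg2 nu)%:R) / n%:R +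
   @E n (fun nu => \sum_(k < K.+2) 1 * (num_trees k nu)%:R) / n%:R + @E n (fun nu => (dense_mass K.+1 nu)%:R) / n%:R
   + @E n (fun nu => (deg3_mass nu)%:R) / n%:R) + K.+1%:R^-1)); last first.
  rewrite [leRHS]addrAC lerD2r; near: n; apply: H; rewrite -subr_gt0.
  have -> : \sum_(k < K.+1) 1 * tau c k = \sum_(k < K.+1) tau c k.
    by apply: eq_bigr => k _; rewrite mul1r.
  by lra.
rewrite /h -!mulrDl -!expectD ler_pdivrMr // mulrDl mulfVK ?gt_eqF //.
rewrite -[X in _ <= _ + X](expect_cst 'I_(m n) (sum_nbr_weight n (p n))) -expectD.
apply: expect_le => [N|nu]; first exact: nbr_weight_ge0.
under eq_bigr do rewrite mul1r.
have /andP[_ le] := excess_pair_seq nu; have le2 := ncl_pair_seq_le K.+1 nu.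
apply: (@le_trans _ _ ((num_deg2 nu)%:R + (ncl (pair_seq nu))%:R + (deg3_mass nu)%:R)).
  by rewrite -!natrD ler_nat.
rewrite -natr_sum.
have {}le2 : (ncl (pair_seq nu))%:R <= (\sum_(i < K.+2) num_trees i nu)%:R + (dense_mass K.+1 nu)%:R + K.+1%:R^-1 * n%:R :> R.
  rewrite -(ler_pM2l k0) mulrDr mulVKf ?gt_eqF //.
  by rewrite -natrD -!natrM -natrD ler_nat.
move: le2; set X := (ncl _)%:R; set Y := (\sum_(i < _) _)%:R.
set Z := (dense_mass _ _)%:R; set W := (deg3_mass _)%:R; set V := (num_deg2 _)%:R; set U := _ * n%:R.
by lra.
Unshelve. all: by end_near. Qed.

(** The limit form of [excess] being at least n. At c = 1 it is the starting value for the
    positivity of [mu]. *)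
Lemma sum_tau_ge K : 0 <= c / 2 - 1 + \sum_(k < K.+1) tau c k + K.+1%:R^-1.
Proof.
rewrite leNgt; apply/negP => lt.
(* Half of the supposed deficit, so that the upper bound on [h n] is still below 1. *)
pose e := - (c / 2 - 1 + \sum_(k < K.+1) tau c k + K.+1%:R^-1) / 2.
have e0 : 0 < e by rewrite divr_gt0 // oppr_gt0.
have [n [hn [pn n0]]] : exists n, h n <= c / 2 + \sum_(k < K.+1) tau c k + K.+1%:R^-1 + e /\
    0 <= p n <= 1 /\ (0 < n)%N.
  have /filter_ex [n [[? ?] ?]] : \forall n \near \oo,
      (h n <= c / 2 + \sum_(k < K.+1) tau c k + K.+1%:R^-1 + e /\ 0 <= p n <= 1) /\ (0 < n)%N.
    apply: filterI; last exact: n_gt0.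
    by apply: filterI => //; apply: expect_excess_le.
  by exists n.
have : 1 <= h n.
  rewrite ler_pdivlMr ?ltr0n // mul1r -[leLHS](expect_cst 'I_(m n) (sum_nbr_weight n (p n))).
  apply: expect_le => [N|nu]; first exact: nbr_weight_ge0.
  by rewrite ler_nat; have := ncl_size (star_seq nu); rewrite card_ord addnC.
move=> h1; move: (le_trans h1 hn) lt; rewrite /e.
by set A := \sum_(k < _) _; set B := K.+1%:R^-1; clearbody A B; lra.
Qed.

End Sparse.
End Limits.

(** * The constant and the theorem *)

Section Mu.
Variable R : realType.

(** With v = k + 1 this is v^(v-2) / v!, the coefficient of the exponential generating function of
    labelled trees. *)
Definition tree_coef k : R := k.+1%:R ^+ k / k.+1%:R / (k.+1)`!%:R.

Lemma tree_coef_ge0 k : 0 <= tree_coef k.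
Proof. by rewrite !divr_ge0 ?exprn_ge0. Qed.

Lemma tauE (c : R) k : c * tau c k = tree_coef k * (c * expR (- c)) ^+ k.+1.
Proof.
rewrite /tau /tree_coef exprMn exprS -[expR (- c) ^+ _]expRM_natl mulrN.
by ring.
Qed.

Lemma tau_ge0 (c : R) k : 0 <= c -> 0 <= tau c k.
Proof. by move=> c0; rewrite mulr_ge0 ?expR_ge0 // !divr_ge0 ?mulr_ge0 ?exprn_ge0. Qed.

Lemma is_derive_tree_series K (t : R) :
  is_derive t 1 (fun u : R => \sum_(k < K) tree_coef k * (u * expR (- u)) ^+ k.+1)
    ((1 - t) * expR (- t) * \sum_(k < K) tree_coef k * k.+1%:R * (t * expR (- t)) ^+ k).
Proof.
have d1 : is_derive t 1 (fun u : R => u * expR (- u)) ((1 - t) * expR (- t)).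
  have dn : is_derive t 1 (fun u : R => expR (- u)) (- expR (- t)).
    have := @is_derive1_comp R expR -%R t (expR (- t)) (- 1) (is_derive_expR _) _.
    by rewrite mulrN1; apply; apply: is_deriveNid.
  have := @is_deriveM R R (fun u => u) (fun u => expR (- u)) t 1 1 (- expR (- t)) (is_derive_id _ _) dn.
  by move/is_derive_eq; apply; rewrite /GRing.scale /=; ring.
elim: K => [|K IH].
  under eq_fun do rewrite big_ord0.
  by rewrite big_ord0 mulr0; exact: is_derive_cst.
under eq_fun do rewrite big_ord_recr /=.
have dX := @is_deriveX R R _ K.+1 t 1 _ d1.
rewrite exprfctE in dX.
have dZ := @is_deriveZ R R R _ (tree_coef K) t 1 _ dX.
apply: is_derive_eq (@is_deriveD R R R _ _ t 1 _ _ IH dZ) _.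
by rewrite big_ord_recr /= /GRing.scale /=; ring.
Qed.

(* With [x = t e^-t <= e^-1], the derivative of [t^2/2 - t + sum_k a_k x^(k+1)] is
   [(t - 1)(1 - T(x)/t)] where [T(x) <= T(e^-1) <= 1]. *)
Lemma excess_growth (c : R) K : 1 < c ->
  \sum_(k < K) k.+1%:R * tau (1 : R) k <= 1 ->
  2^-1 - 1 + \sum_(k < K) tau (1 : R) k + (c - 1) ^+ 3 / (3 * c) <=
  c * (c / 2 - 1 + \sum_(k < K) tau c k).
Proof.
move=> c1 T1; have c0 : 0 < c by apply: lt_trans c1.
pose S (u : R) := \sum_(k < K) tree_coef k * (u * expR (- u)) ^+ k.+1.
pose dS (u : R) := (1 - u) * expR (- u) * \sum_(k < K) tree_coef k * k.+1%:R * (u * expR (- u)) ^+ k.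
(* The subtracted cubic has derivative (u - 1)^2 / c, at most (u - 1)(1 - 1/u) = (u - 1)^2 / u on
   [1, c]. Monotonicity of [f] thus gives a gain independent of [K]. *)
pose q (u : R) := u ^+ 2 / 2 - u - (u - 1) ^+ 3 / (3 * c).
have dq (u : R) : is_derive u 1 q (u - 1 - (u - 1) ^+ 2 / c).
  rewrite /q; apply: is_derive_eq; rewrite /GRing.scale /=.
  by field; rewrite gt_eqF.
pose f (u : R) := q u + S u.
have df (u : R) : is_derive u 1 f (u - 1 - (u - 1) ^+ 2 / c + dS u).
  exact: (@is_deriveD R R R q S u 1 _ _ (dq u) (is_derive_tree_series K u)).
have SE (u : R) : S u = u * \sum_(k < K) tau u k.
  by rewrite /S big_distrr /=; apply: eq_bigr => k _; rewrite tauE.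
have cont : {within `[1, c], continuous f}.
  by apply: derivable_within_continuous => u _; apply: ex_derive.
have [t] := MVT c1 (fun u _ => df u) cont.
rewrite in_itv /= => /andP[t1 tc] E.
have t0 : 0 < t by apply: lt_trans t1.
have TE : t * (expR (- t) * \sum_(k < K) tree_coef k * k.+1%:R * (t * expR (- t)) ^+ k) <= 1.
  apply: le_trans T1; rewrite mulrA big_distrr /=; apply: ler_sum => k _.
  have -> : t * expR (- t) * (tree_coef k * k.+1%:R * (t * expR (- t)) ^+ k) =
     k.+1%:R * (tree_coef k * (t * expR (- t)) ^+ k.+1) by rewrite exprS; ring.
  rewrite ler_wpM2l // -[tau (1 : R) k]mul1r tauE mul1r ler_wpM2l ?tree_coef_ge0 //.
  rewrite lerXn2r ?nnegrE ?mulr_ge0 ?expR_ge0 ?(ltW t0) //.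
  have := expR_ge1Dx (t - 1); rewrite addrC subrK expRD => h.
  apply: le_trans (ler_wpM2r (expR_ge0 (- t)) h) _.
  by rewrite mulrAC -expRD subrr expR0 mul1r.
have : 0 <= t - 1 - (t - 1) ^+ 2 / c + dS t.
  rewrite /dS -mulrA; set X := expR _ * _ in TE *.
  have Xt : X <= t^-1 by rewrite -(ler_pM2l t0) mulfV ?gt_eqF.
  have : c^-1 <= t^-1 by rewrite lef_pV2 ?posrE // ltW.
  have tV : t^-1 * t = 1 by rewrite mulVf // gt_eqF.
  have u0 : 0 <= t - 1 by rewrite subr_ge0 ltW.
  move=> ct; have := ler_wpM2l u0 Xt; have := ler_wpM2l (sqr_ge0 (t - 1)) ct.
  have : (t - 1) ^+ 2 * t^-1 = (t - 1) - (t - 1) * t^-1.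
    by field; rewrite gt_eqF.
  move: X {TE} Xt => X _; move: (t^-1) {tV ct} => V; move: (c^-1) => W; nra.
have cc : 0 <= c - 1 by rewrite subr_ge0 ltW.
move=> /mulr_ge0 /(_ cc); rewrite -E /f !SE /q; nra.
Qed.

Definition mu_sum (c : R) (N : nat) : R := \sum_(k < N) tau c k.

Lemma mu_sum_cvg (c : R) : 0 <= c -> (forall N, mu_sum c N <= 1) -> cvgn (mu_sum c).
Proof.
move=> c0 H; apply: nondecreasing_is_cvgn; last by exists 1 => _ [N _ <-].
apply/nondecreasing_seqP => N; rewrite /mu_sum big_ord_recr /= lerDl.
exact: tau_ge0.
Qed.

Lemma muE (c : R) : 0 < c -> cvgn (mu_sum c) ->
  mu c * c = c / 2 - 1 + limn (mu_sum c).
Proof.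
move=> c0 H; rewrite /mu.
have H2 : (fun N => \sum_(1 <= k < N) (c * expR (- c)) ^+ k * (k%:R ^+ (k - 2) / (k`!)%:R)) @ \oo
    --> c * limn (mu_sum c).
  rewrite -cvg_shiftS /=.
  have -> : (fun N => \sum_(1 <= k < N.+1) (c * expR (- c)) ^+ k * (k%:R ^+ (k - 2) / (k`!)%:R)) =
     (fun N => c * mu_sum c N).
    apply/funext => N; rewrite big_add1 big_mkord /mu_sum big_distrr /=.
    apply: eq_bigr => k _; rewrite tauE mulrC; congr (_ * _); rewrite /tree_coef; congr (_ / _).
    (* For the one-vertex tree the truncated exponent 1 - 2 = 0 gives 1, as the exponent -1
       would. *)
    case: (nat_of_ord k) => [|j]; first by rewrite !expr0 divr1.
    by rewrite [in RHS]exprSr mulfK ?pnatr_eq0 // subSS subSS subn0.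
  by apply: cvgM => //; exact: cvg_cst.
rewrite (cvg_lim _ H2) //.
by field; rewrite gt_eqF.
Qed.

(** At c = 1 the partial expression is at least -1/(K+1), and [excess_growth] adds a positive amount
    that does not depend on [K]; a large [K] wins. *)
Lemma mu_gt0 (c : R) : 1 < c -> (forall N, mu_sum c N <= 1) ->
  (forall K, \sum_(k < K) k.+1%:R * tau (1 : R) k <= 1) ->
  (forall K, 0 <= 1 / 2 - 1 + \sum_(k < K.+1) tau (1 : R) k + K.+1%:R^-1) ->
  0 < mu c * c.
Proof.
move=> c1 Hc T1 T2; have c0 : 0 < c by apply: lt_trans c1.
have cv := mu_sum_cvg (ltW c0) Hc; rewrite muE //.
pose dl := (c - 1) ^+ 3 / (3 * c).
have dl0 : 0 < dl by rewrite divr_gt0 ?exprn_gt0 ?subr_gt0 ?mulr_gt0.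
have key K : dl - K.+1%:R^-1 <= c * (c / 2 - 1 + limn (mu_sum c)).
  have le : mu_sum c K.+1 <= limn (mu_sum c).
    apply: nondecreasing_cvgn_le cv _; apply/nondecreasing_seqP => N.
    by rewrite /mu_sum [leRHS]big_ord_recr /= lerDl; apply: tau_ge0; apply: ltW.
  have := excess_growth c1 (T1 K.+1); have := T2 K; rewrite -/(mu_sum c K.+1) -/dl mul1r.
  have := ler_wpM2l (ltW c0) le.
  move: (\sum_(k < _) _) (K.+1%:R^-1) (mu_sum c K.+1) (limn (mu_sum c) : R) dl {dl0 le} => A B M Lm dl.
  nra.
rewrite -(pmulr_rgt0 _ c0).
have dl2 : 0 < dl / 2 by apply: divr_gt0.
have [K hK] : exists K : nat, K.+1%:R^-1 < dl / 2.
  exists (Num.truncn (dl / 2)^-1); rewrite -[ltRHS]invrK ltf_pV2 ?posrE ?invr_gt0 //.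
  exact: truncnS_gt.
apply: lt_le_trans (key K); rewrite subr_gt0; apply: lt_trans hK _.
by move: dl dl0 {key dl2} => x; lra.
Qed.

End Mu.

(** * Positivity of the constant and concentration of the genus *)

Section BipartiteGenus.
Variable R : realType.
Variable n2 : nat -> nat.
Hypothesis n2_gt0 : forall n, (0 < n2 n)%N.
Hypothesis n2_large : (fun n : nat => n%:R / (n2 n)%:R : R) @ \oo --> 0.

Let p (d : R) (n : nat) : R := d / Num.sqrt ((n * n2 n)%N%:R).

Lemma edge_prob_sqr (d : R) n : (0 < n)%N -> n%:R * (n2 n)%:R * p d n ^+ 2 = d ^+ 2.
Proof.
move=> n0; have x0 : 0 < (n * n2 n)%N%:R :> R by rewrite ltr0n muln_gt0 n0 n2_gt0.
rewrite /p exprMn exprVn sqr_sqrtr ?(ltW x0) // natrM.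
by field; rewrite !pnatr_eq0 -!lt0n n0 n2_gt0.
Qed.

Lemma edge_prob_mul_cvg (d : R) : 0 <= d -> (fun n => n%:R * p d n) @ \oo --> (0 : R).
Proof.
move=> d0.
have H : (fun n => Num.sqrt (d ^+ 2 * (n%:R / (n2 n)%:R))) @ \oo --> Num.sqrt (d ^+ 2 * 0).
  apply: continuous_cvg; first exact: sqrt_continuous.
  by apply: cvgM; [exact: cvg_cst|exact: n2_large].
rewrite mulr0 sqrtr0 in H; apply: cvg_trans H; apply: near_eq_cvg.
near=> n; have n0 : (0 < n)%N by near: n; exists 1%N.
have m0 : (n2 n)%:R != 0 :> R by rewrite pnatr_eq0 -lt0n.
have -> : d ^+ 2 * (n%:R / (n2 n)%:R) = (n%:R * p d n) ^+ 2.
  by rewrite -(edge_prob_sqr d n0); field.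
by rewrite sqrtr_sqr ger0_norm // mulr_ge0 // divr_ge0 ?sqrtr_ge0.
Unshelve. all: by end_near. Qed.

Lemma edge_prob01 (d : R) : 0 <= d -> \forall n \near \oo, 0 <= p d n <= 1.
Proof.
move=> d0; have H := cvgr_le _ (edge_prob_mul_cvg d0) 1 ltr01.
near=> n; have n0 : (0 < n)%N by near: n; exists 1%N.
have p0 : 0 <= p d n by rewrite divr_ge0 ?sqrtr_ge0.
rewrite p0 /=; apply: le_trans (_ : n%:R * p d n <= 1); last by near: n; exact: H.
by rewrite ler_peMl // ler1n.
Unshelve. all: by end_near. Qed.

Lemma n2_cvgoo : n2 @ \oo --> \oo.
Proof.
apply/cvgnyPge => A; have H := cvgr_lt _ n2_large 1 ltr01.
near=> n; apply: ltnW; apply: (@leq_ltn_trans n); first by near: n; exact: nbhs_infty_ge.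
have : n%:R / (n2 n)%:R < 1 :> R by near: n; exact: H.
by rewrite ltr_pdivrMr ?ltr0n // mul1r ltr_nat.
Unshelve. all: by end_near. Qed.

Lemma edge_prob_sqr_near (d : R) : \forall n \near \oo, n%:R * (n2 n)%:R * p d n ^+ 2 = d ^+ 2.
Proof. by exists 1%N => // n n0; apply: edge_prob_sqr. Qed.

Lemma mu_sum_le1 (d : R) N : 0 < d -> mu_sum (d ^+ 2) N <= 1.
Proof.
move=> d0; have d20 : 0 < d ^+ 2 by rewrite exprn_gt0.
apply: le_trans (sum_tau_size_le1 (edge_prob01 (ltW d0)) (edge_prob_sqr_near d)
  (edge_prob_mul_cvg (ltW d0)) n2_cvgoo N).
apply: ler_sum => k _; rewrite ler_peMl ?ler1n //; apply: tau_ge0; exact: ltW.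
Qed.

(** The bounds at c = 1 come from the random graph with the same [n2] and d = 1. *)
Lemma mu_sqr_gt0 (d : R) : 1 < d -> 0 < mu (d ^+ 2) * d ^+ 2.
Proof.
move=> d1; have d0 : 0 < d by apply: lt_trans d1.
apply: mu_gt0 => [|N|K|K]; first by rewrite expr_gt1 // ltW.
- exact: mu_sum_le1.
- have := sum_tau_size_le1 (edge_prob01 ler01) (edge_prob_sqr_near 1)
    (edge_prob_mul_cvg ler01) n2_cvgoo K.
  by rewrite expr1n.
- have := sum_tau_ge (exprn_gt0 2 ltr01) (edge_prob01 ler01) (edge_prob_sqr_near 1)
    (edge_prob_mul_cvg ler01) n2_cvgoo K.
  by rewrite expr1n.
Qed.

Lemma prob_bipE (n m : nat) (q : R) (P : {set 'I_n * 'I_m} -> Prop) :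
  prob_bip n m q P = expect (@nbr_weight R n q)
    (fun nu : {ffun 'I_m -> {set 'I_n}} => `[< P (graph_of nu) >]%:R).
Proof.
rewrite -(sum_graphs q (fun S => `[< P S >]%:R)) /prob_bip big_mkcond; apply: eq_bigr => S _.
by case: asboolP; rewrite ?mulr1 ?mulr0.
Qed.

Section Concentration.
Variable d : R.
Hypothesis d1 : 1 < d.
Let c := d ^+ 2.
Let M := mu c * c.
Let d0 : 0 < d. Proof. exact: lt_trans d1. Qed.
Let c0 : 0 < c. Proof. by rewrite exprn_gt0. Qed.
Let q := p d.
Let q01 := edge_prob01 (ltW d0).
Let qc : \forall n \near \oo, n%:R * (n2 n)%:R * q n ^+ 2 = c := edge_prob_sqr_near d.
Let nq0 := edge_prob_mul_cvg (ltW d0).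
Let E n (f : {ffun 'I_(n2 n) -> {set 'I_n}} -> R) := expect (@nbr_weight R n (q n)) f.
Let h n (nu : {ffun 'I_(n2 n) -> {set 'I_n}}) : R := (excess (star_seq nu))%:R.
Let mean n : R := @E n (@h n).

(** Edges contribute c/2 and tree components the limit of [mu_sum]; the 1 is the shift by n in
    [excess], and [M] is twice the predicted genus per left vertex. *)
Lemma mean_excess_near (dl : R) : 0 < dl ->
  \forall n \near \oo, `|mean n / n%:R - (1 + M)| <= dl.
Proof.
move=> dl0.
have cv : cvgn (mu_sum c) by apply: mu_sum_cvg (ltW c0) _ => N; apply: mu_sum_le1.
have ME : 1 + M = c / 2 + limn (mu_sum c) by rewrite /M muE //; ring.
have nd : nondecreasing_seq (mu_sum c).
  by apply/nondecreasing_seqP => N; rewrite /mu_sum [leRHS]big_ord_recr /= lerDl; apply: tau_ge0; apply: ltW.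
have dl2 : 0 < dl / 2 by rewrite divr_gt0.
have [K [K1 K2]] : exists K : nat, limn (mu_sum c) - dl / 2 <= mu_sum c K /\ K.+1%:R^-1 <= dl / 2.
  have /filter_ex [K [? ?]] : \forall K \near \oo, limn (mu_sum c) - dl / 2 <= mu_sum c K /\ K.+1%:R^-1 <= dl / 2.
    apply: filterI.
      by apply: (cvgr_ge _ cv); rewrite gtrBl.
    by apply: (cvgr_le _ (@cvg_harmonic R)).
  by exists K.
have lo := expect_excess_ge q01 qc nq0 n2_cvgoo K dl2.
have up := expect_excess_le c0 q01 qc nq0 n2_cvgoo K dl2.
have K3 := nondecreasing_cvgn_le nd cv K.+1.
near=> n.
have lon : c / 2 + mu_sum c K - dl / 2 <= mean n / n%:R by near: n; exact: lo.
have upn : mean n / n%:R <= c / 2 + mu_sum c K.+1 + K.+1%:R^-1 + dl / 2 by near: n; exact: up.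
rewrite ler_distlC ME.
move: (mean n / n%:R) lon upn K1 K2 K3 => x.
move: (K.+1%:R^-1) (mu_sum c K.+1) (mu_sum c K) (limn (mu_sum c) : R) => A B C L0 *.
by apply/andP; split; lra.
Unshelve. all: by end_near. Qed.

(** The gap allowed by [genus_bounds], divided by [L]. *)
Let err n L (nu : {ffun 'I_(n2 n) -> {set 'I_n}}) : R :=
  (deg3_mass nu)%:R + (dense_mass L nu)%:R + 2 / L%:R * (num_deg2 nu)%:R.

Lemma err_cvg L : (fun n => @E n (@err n L) / n%:R) @ \oo --> c / L%:R.
Proof.
have H : (fun n => @E n (fun nu => (deg3_mass nu)%:R) / n%:R + @E n (fun nu => (dense_mass L nu)%:R) / n%:R +
   2 / L%:R * (@E n (fun nu => (num_deg2 nu)%:R) / n%:R)) @ \oo --> 0 + 0 + 2 / L%:R * (c / 2).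
  apply: cvgD; first apply: cvgD.
  - exact: (expect_deg3_cvg c0 q01 qc nq0).
  - exact: (expect_dense_cvg q01 qc).
  - by apply: cvgM; [exact: cvg_cst|exact: (expect_num_deg2_cvg q01 qc nq0)].
have E0 : 0 + 0 + 2 / L%:R * (c / 2) = c / L%:R.
  by rewrite !add0r; move: (L%:R^-1) => x; field.
rewrite E0 in H; apply: cvg_trans H; apply: near_eq_cvg; near=> n.
by rewrite /E /err !expectD expectZ !mulrDl -!mulrA.
Unshelve. all: by end_near. Qed.

(* Chebyshev for [h] and Markov for [err]. *)
Lemma failure_le (e dl : R) n L (nu : {ffun 'I_(n2 n) -> {set 'I_n}}) :
  0 < dl -> 3 * dl <= e * M -> (0 < n)%N -> (0 < L)%N ->
  `|mean n / n%:R - (1 + M)| <= dl ->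
  1 - ((h nu - mean n) ^+ 2 / (dl * n%:R) ^+ 2 + err L nu / (dl * n%:R)) <=
  (`[< exists2 g : nat, is_genus (bip_adj (graph_of nu)) g &
    `|g%:R - mu c * c * n%:R / 2| <= e * (mu c * c * n%:R / 2) >])%:R.
Proof.
move=> dl0 edl n0 L0 hm.
have N0 : 0 < n%:R :> R by rewrite ltr0n.
have L0' : 0 < L%:R :> R by rewrite ltr0n.
have t0 : 0 < dl * n%:R by rewrite mulr_gt0.
have er0 : 0 <= err L nu by rewrite !addr_ge0 // mulr_ge0 // divr_ge0.
case: asboolP => [_|bad].
  by rewrite gerBl addr_ge0 // divr_ge0 ?sqr_ge0 ?(ltW t0).
rewrite subr_le0; have [far|near] := leP (dl * n%:R) `|h nu - mean n|.
  apply: (@le_trans _ _ ((h nu - mean n) ^+ 2 / (dl * n%:R) ^+ 2)); last first.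
    by rewrite lerDl divr_ge0 // ltW.
  by rewrite ler_pdivlMr ?exprn_gt0 // mul1r -[leRHS]real_normK ?num_real // lerXn2r ?nnegrE // ltW.
have [fare|neare] := leP (dl * n%:R) (err L nu).
  apply: (@le_trans _ _ (err L nu / (dl * n%:R))); first by rewrite ler_pdivlMr // mul1r.
  by rewrite lerDr divr_ge0 ?sqr_ge0.
exfalso; apply: bad; have [g gg] := genus_bounds (graph_of nu) L.
rewrite nbr_graph_of => -[up lo]; exists g => //.
have up' : 2 * g%:R + n%:R <= h nu by rewrite /h -natrM -natrD ler_nat.
have lo' : h nu <= 2 * g%:R + n%:R + err L nu.
  have lo2 : L%:R * h nu <= (L * (2 * g + n + deg3_mass nu + dense_mass L nu) + 2 * num_deg2 nu)%N%:R.
    by rewrite /h -natrM ler_nat.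
  rewrite -(ler_pM2l L0'); apply: le_trans lo2 _.
  rewrite !(natrD, natrM) le_eqVlt; apply/orP; left; apply/eqP.
  by rewrite /err; field; rewrite gt_eqF.
have hm' : `|mean n - (1 + M) * n%:R| <= dl * n%:R.
  have -> : mean n - (1 + M) * n%:R = (mean n / n%:R - (1 + M)) * n%:R.
    by field; rewrite gt_eqF.
  by rewrite normrM (ger0_norm (ltW N0)) ler_wpM2r // ltW.
have edl' : 3 * (dl * n%:R) <= e * (M * n%:R).
  by have := ler_wpM2r (ltW N0) edl; rewrite -!mulrA.
have EM : mu c * c * n%:R = M * n%:R by [].
rewrite EM; move: near hm'; rewrite ltr_norml ler_norml => /andP[n1 n2'] /andP[m1 m2].
move: (h nu) (mean n) (err L nu) (M * n%:R) (M) (dl * n%:R) (n%:R : R) (g%:R : R) up' lo' n1 n2' m1 m2 edl' neare er0.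
move=> hh mm er Mn M' t N G *; rewrite ler_norml; apply/andP; split; nra.
Qed.

Lemma genus_concentrates (e : R) : 0 < e ->
  (fun n => prob_bip n (n2 n) (q n) (fun S => exists2 g : nat, is_genus (bip_adj S) g &
    `|g%:R - mu c * c * n%:R / 2| <= e * (mu c * c * n%:R / 2))) @ \oo --> (1 : R).
Proof.
move=> e0; have M0 : 0 < M by apply: mu_sqr_gt0.
(* Three errors share the tolerance: the fluctuation of the excess, the distance of its mean from (1
   + M) n, and [err]. *)
pose dl := e * M / 3; have dl0 : 0 < dl by apply: divr_gt0 => //; apply: mulr_gt0.
have edl : 3 * dl <= e * M by rewrite /dl mulrC mulfVK // pnatr_eq0.
apply/cvgrPdist_le => eta eta0.
(* Markov's bound for [err] tends to c / (L dl), so [L] is fixed before n grows; Chebyshev's bound c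
   / (dl^2 n) vanishes by itself. *)
have [L [L0 hL]] : exists L : nat, (0 < L)%N /\ c / L%:R / dl < eta.
  exists (Num.truncn (c / dl / eta)).+1; split=> //.
  have := truncnS_gt (c / dl / eta); set T := (_.+1)%:R => hT.
  have T0 : 0 < T by rewrite ltr0n.
  by rewrite [ltLHS]mulrAC ltr_pdivrMr // [ltRHS]mulrC -ltr_pdivrMr.
have H : (fun n => c / dl ^+ 2 * n%:R^-1 + @E n (@err n L) / n%:R / dl) @ \oo -->
    c / dl ^+ 2 * 0 + c / L%:R / dl.
  apply: cvgD; last by apply: cvgMl; exact: err_cvg.
  by apply: cvgM; [exact: cvg_cst|exact: (@cvg_invn R (fun n => n) cvg_id)].
rewrite mulr0 add0r in H; have {}H := cvgr_le _ H _ hL.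
have var := variance_excess_le q01 qc; have me := mean_excess_near dl0.
near=> n.
have qn : 0 <= q n <= 1 by near: n.
have n0 : (0 < n)%N by near: n; exists 1%N.
have N0 : 0 < n%:R :> R by rewrite ltr0n.
have hme : `|mean n / n%:R - (1 + M)| <= dl by near: n; exact: me.
have hvar : @E n (fun nu => (h nu - mean n) ^+ 2) <= c * n%:R by near: n; exact: var.
have hB : c / dl ^+ 2 * n%:R^-1 + @E n (@err n L) / n%:R / dl <= eta by near: n; exact: H.
have one : @E n (fun=> 1) = 1 by apply: expect_cst; apply: sum_nbr_weight.
rewrite prob_bipE; set ind := fun nu => _.
rewrite ger0_norm; last first.
  rewrite subr_ge0 -[leRHS]one; apply: expect_le => [N|nu]; first exact: nbr_weight_ge0.
  by rewrite /ind; case: asboolP.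
rewrite lerBlDl -lerBlDr; apply: le_trans (_ : @E n (fun nu =>
    1 - ((h nu - mean n) ^+ 2 / (dl * n%:R) ^+ 2 + err L nu / (dl * n%:R))) <= _); last first.
  by apply: expect_le => [N|nu]; [exact: nbr_weight_ge0|exact: failure_le].
rewrite {1}/E expectB expectD -/(@E n _) one lerD2l lerN2; apply: le_trans hB.
have -> : expect (@nbr_weight R n (q n)) (fun nu : {ffun 'I_(n2 n) -> {set 'I_n}} => (h nu - mean n) ^+ 2 / (dl * n%:R) ^+ 2) =
    @E n (fun nu => (h nu - mean n) ^+ 2) / (dl * n%:R) ^+ 2.
  by rewrite /E [RHS]mulrC -expectZ; apply: eq_expect => nu; rewrite mulrC.
have -> : expect (@nbr_weight R n (q n)) (fun nu : {ffun 'I_(n2 n) -> {set 'I_n}} => err L nu / (dl * n%:R)) =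
    @E n (@err n L) / (dl * n%:R).
  by rewrite /E [RHS]mulrC -expectZ; apply: eq_expect => nu; rewrite mulrC.
apply: lerD; last by rewrite invfM [dl^-1 * _]mulrC mulrA.
have t0 : 0 < dl * n%:R by apply: mulr_gt0.
rewrite (ler_pdivrMr _ _ (exprn_gt0 2 t0)); apply: le_trans hvar _.
rewrite le_eqVlt; apply/orP; left; apply/eqP; field.
by rewrite (gt_eqF N0) (gt_eqF dl0).
Unshelve. all: by end_near. Qed.

End Concentration.
End BipartiteGenus.

(* n1 = n -> oo, n2 = n2 n with n1 << n2, p = d / sqrt(n1 n2), d > 1:
   for every eps > 0, whp |g(G) - mu(d^2) d^2 n1 / 2| <= eps * mu(d^2) d^2 n1 / 2 *)
Theorem theorem1p6 (R : realType) (d : R) (hd : 1 < d)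
  (n2 : nat -> nat) (hn2pos : forall n, (0 < n2 n)%N)
  (hn2 : (fun n : nat => n%:R / (n2 n)%:R : R) @ \oo --> 0)
  (eps : R) (heps : 0 < eps) :
  (fun n : nat =>
     (prob_bip n (n2 n) (d / Num.sqrt ((n * n2 n)%N%:R))
       ((fun S => exists2 g : nat, is_genus (bip_adj S) g &
          (`| (g%:R - mu (d ^+ 2) * d ^+ 2 * n%:R / 2 : R) |
             <= eps * (mu (d ^+ 2) * d ^+ 2 * n%:R / 2)))) : R))
  @ \oo --> (1 : R).
Proof. exact: genus_concentrates. Qed.
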